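(* Let $f:\mathbb{Z}\setminus\{0\}\to\mathbb{C}$ satisfy $f(m)=o(1)$ as $|m|\to\infty$, let $k$ be a positive integer and $a\in\mathbb{R}\setminus\{0\}$. For integers $0\le l\le j$ put $S(j,l):=\sum_{(r_0,\dots,r_l)\in\mathbb{N}_0^{l+1},\ r_0+\cdots+r_l=j-l}\prod_{h=0}^{l}(2h+1)^{2r_h}$. Then $$\sum_{m,n\in\mathbb{Z},\,m\neq 0}\frac{f(m)(-1)^n}{(m+ani)^{2k}}=\frac{\pi^{2k}}{a^{2k}(2k-1)!}\sum_{l=0}^{k-1}(2l+1)!\,S(k-1,l)\sum_{m=1}^\infty\frac{\big(f(m)+f(-m)\big)\cosh(m\pi/a)}{\sinh^{2l+2}(m\pi/a)},$$ $$\sum_{m,n\in\mathbb{Z},\,m\neq 0}\frac{f(m)(-1)^n}{(m+ani)^{2k-1}}=\frac{\pi^{2k-1}}{a^{2k-1}(2k-2)!}\sum_{l=0}^{k-1}(2l)!\,S(k-1,l)\sum_{m=1}^\infty\frac{f(m)-f(-m)}{\sinh^{2l+1}(m\pi/a)}.$$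
   Context: $i=\sqrt{-1}$, $\mathbb{N}_0$ is the set of nonnegative integers. A double sum $\sum_{m,n\in\mathbb{Z},\,m\neq0}F(m,n)$ means the iterated sum $\sum_{m\in\mathbb{Z}\setminus\{0\}}\lim_{N\to\infty}\sum_{n=-N}^{N}F(m,n)$ (for exponent at least $2$ the inner sum converges absolutely; for exponent $1$ the symmetric limit is essential). *)

(* Defs.v *)
(* The analysis is Stdlib's R with Coquelicot's C; MathComp is only used for
   the finite sum S(j,l). *)
From mathcomp Require Import all_boot.

(* Since the r_h are natural numbers of sum j - l, each one is at most j - l;
   hence the finite type of the index r. *)
Definition S_coef (j l : nat) : nat :=
  (\sum_(r : {ffun 'I_l.+1 -> 'I_(j - l).+1} | \sum_(h < l.+1) r h == j - l)
     \prod_(h < l.+1) (2 * h + 1) ^ (2 * r h))%N.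

From Stdlib Require Import Reals ZArith List.
From Coquelicot Require Import Coquelicot.

(* f m = o(1) as |m| -> oo; f 0 is a junk value, and this does not constrain it
   since M may be taken nonnegative. *)
Definition vanishes_at_infty (f : Z -> C) : Prop :=
  forall eps : R, (0 < eps)%R ->
    exists M : Z, forall m : Z, (M < Z.abs m)%Z -> (Cmod (f m) < eps)%R.

(* s = lim_{N -> oo} sum_{n = -N}^{N} u n *)
Definition is_symmetric_sum (u : Z -> C) (s : C) : Prop :=
  filterlim
    (fun N : nat =>
       sum_n (G := C_AbelianMonoid)
         (fun j : nat => u (Z.of_nat j - Z.of_nat N)%Z) (2 * N)%nat)
    eventually (locally (T := C_UniformSpace) s).

(* s = sum_{m in Z \ {0}} g m, as an unordered sum: the limit along the finite
   subsets of Z \ {0}, directed by inclusion. *)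
Definition is_sum_nonzero (g : Z -> C) (s : C) : Prop :=
  forall eps : R, (0 < eps)%R ->
    exists L0 : list Z, ~ In 0%Z L0 /\
      forall L : list Z, NoDup L -> ~ In 0%Z L -> incl L0 L ->
        (Cmod (fold_right Cplus (RtoC 0) (map g L) - s)%C < eps)%R.

(* s = sum_{m <> 0} lim_{N -> oo} sum_{n = -N}^{N} F m n, including the
   existence of all the limits involved. *)
Definition is_double_sum (F : Z -> Z -> C) (s : C) : Prop :=
  exists g : Z -> C,
    (forall m : Z, m <> 0%Z -> is_symmetric_sum (F m) (g m)) /\
    is_sum_nonzero g s.

(* Main.v *)
Require Import Defs.
From mathcomp Require all_boot all_algebra.
From Stdlib Require Import Reals ZArith List Permutation ClassicalEpsilon Lra Lia.
From Coquelicot Require Import Coquelicot.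

(** The function cosh (y t) on [-pi, pi] has Fourier coefficients
    (-1)^n y sinh (pi y) / (pi (y^2 + n^2)), and convergence of its Fourier series
    at t = 0 gives the partial fraction expansion
      pi / sinh (pi y) = sum_n (-1)^n / (y + n i)        (symmetric summation).
    Differentiating termwise in y raises the exponent on the right, while on the
    left (sinh^-(2l+1))'' = (2l+1)^2 sinh^-(2l+1) + (2l+1)(2l+2) sinh^-(2l+3)
    reproduces the recurrence S(j+1,l) = (2l+1)^2 S(j,l) + S(j,l-1). Taking
    y = m / a evaluates the inner sums; the outer sum converges absolutely because
    f is bounded and 1/sinh decays, and m and -m are then grouped together. *)

(** Terms of index n and -n are conjugate, so folding them turns every inner sum into a real series,
    and the calculus stays in one real variable. Exponent 1 is the delicate case, since the unfolded
    series is not absolutely convergent. It is settled pointwise: sinh (pi y) times a partial sum,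
    minus pi, is the integral over [0, pi] of cosh (y t) - 1 against a Dirichlet kernel. That
    integral tends to 0 by a uniform bound near t = 0 and a Riemann-Lebesgue estimate away from it.
    From exponent 2 on, |y + n i| >= |n| gives an n^-2 bound uniform in y. The differentiated series
    therefore always converge uniformly, and the series being differentiated only has to converge
    pointwise, which is how exponent 1 can start the induction. Passing from exponent p to p + 1
    multiplies the constant by pi / p, whence pi^p / (p-1)!. In the outer sum, 1 / sinh^(2l+1) is
    odd and cosh / sinh^(2l+2) is even in m; this parity selects f(m) - f(-m) or f(m) + f(-m). *)

Module S_coef_theory.
Import all_boot all_algebra.
Import GRing.Theory Num.Theory.

(* The complete homogeneous symmetric polynomial of degree n, evaluated at
   1^2, 3^2, ..., (2l+1)^2. *)
Fixpoint complete_sym (l n : nat) : nat :=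
  if l is l'.+1 then (\sum_(i < n.+1) complete_sym l' i * ((2 * l + 1) ^ 2) ^ (n - i))%N
  else 1%N.

(** Monomials are split according to whether they contain the last variable, (2(l+1)+1)^2: those
    that do have it factored out once, those that do not form the top summand of the defining
    sum. *)
Lemma complete_symS l n :
  complete_sym l.+1 n.+1 =
  ((2 * l.+1 + 1) ^ 2 * complete_sym l.+1 n + complete_sym l n.+1)%N.
Proof.
rewrite /= big_ord_recr /= subnn expn0 muln1; congr (_ + _)%N.
rewrite big_distrr /=; apply: eq_bigr => i _.
have lei : (i <= n)%N by rewrite -ltnS.
by rewrite subSn // expnS mulnCA.
Qed.

Local Open Scope ring_scope.

(* The truncation at degree B does not affect the coefficients below B, so the
   generating function is a product of geometric series. *)
Lemma coef_prod_geom (l B n : nat) : (n < B)%N ->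
  (\prod_(h < l.+1) \poly_(i < B) (((2 * h + 1) ^ (2 * i))%N%:R : int))`_n
  = (complete_sym l n)%:R.
Proof.
elim: l n => [|l IHl] n ltnB.
  by rewrite big_ord1 coef_poly ltnB /= muln0 add0n exp1n.
rewrite big_ord_recr coefM /= natr_sum; apply: eq_bigr => i _.
have lei : (i <= n)%N by rewrite -ltnS.
rewrite IHl ?(leq_ltn_trans lei) // coef_poly.
by rewrite (leq_ltn_trans (leq_subr _ _)) // natrM -expnM.
Qed.

(** Distributing the product of truncated geometric series gives one monomial for each function [r],
    and extracting the coefficient of degree [j - l] imposes the constraint on the sum of [r]. *)
Lemma S_coefE j l : S_coef j l = complete_sym l (j - l).
Proof.
(* Polynomials need a ring of coefficients, hence the move to [int]. Truncation at [(j - l).+1]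
   makes the exponents range over exactly the ordinal type in which [r] takes its values. *)
apply/eqP; rewrite -(eqr_nat int) -(@coef_prod_geom l (j - l).+1) //.
rewrite (eq_bigr (fun h : 'I_l.+1 => \sum_(i < (j - l).+1)
   (((2 * h + 1) ^ (2 * i))%N%:R : int) *: 'X^i)); last by move=> h _; rewrite poly_def.
rewrite bigA_distr_bigA /= coef_sum /S_coef natr_sum big_mkcond /=.
apply/eqP/eq_bigr => r _.
rewrite scaler_prod -expr_sum coefZ coefXn natr_prod eq_sym.
by case: eqP => _; rewrite ?mulr1 ?mulr0.
Qed.

Lemma S_coef_diag j : S_coef j j = 1%N.
Proof.
rewrite S_coefE subnn; elim: j => //= j IHj.
by rewrite big_ord1 IHj expn0.
Qed.

Lemma S_coef_0r j : S_coef j 0 = 1%N.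
Proof. by rewrite S_coefE. Qed.

(** The guard excludes [l = j], where truncated subtraction makes [S_coef j (S l)] equal to 1
    instead of 0. *)
Lemma S_coef_rec j l : (S l <= j)%coq_nat ->
  let c := Nat.add (Nat.mul 2 l) 3 in
  S_coef (S j) (S l) = Nat.add (Nat.mul (Nat.mul c c) (S_coef j (S l))) (S_coef j l).
Proof.
move/leP=> lelj c; rewrite {}/c !S_coefE subSS.
have -> : (j - l = (j - l.+1).+1)%N by rewrite subnSK.
rewrite complete_symS; congr (_ * _ + _)%N.
by rewrite -mulnn !plusE !multE mulnS [(2 + _)%N]addnC -addnA.
Qed.

End S_coef_theory.

Import S_coef_theory.
Open Scope R_scope.

(* Coquelicot states equalities at the carrier of a canonical structure, which
   ring and field do not recognise. *)
Ltac eq_at T := match goal with |- @eq _ ?x ?y => change (@eq T x y) end.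

Lemma sum_Sn_R (u : nat -> R) (n : nat) : sum_n u (S n) = sum_n u n + u (S n).
Proof. exact (sum_Sn u n). Qed.

(** * Partial fractions of csch *)

Lemma is_derive_sinh (x : R) : is_derive sinh x (cosh x).
Proof. apply is_derive_Reals, derivable_pt_lim_sinh. Qed.

Lemma is_derive_cosh (x : R) : is_derive cosh x (sinh x).
Proof. apply is_derive_Reals, derivable_pt_lim_cosh. Qed.

(** The number of integers with absolute value n: the weight both of cos (n t) in the Dirichlet
    kernel and of the folded terms of the symmetric sums. *)
Definition fold_weight (n : nat) : R := match n with O => 1 | _ => 2 end.

Definition dirichlet_kernel (N : nat) (t : R) : R :=
  sum_n (fun n => fold_weight n * cos (INR n * t)) N.

(** Telescoping of 2 sin (t/2) cos (n t) = sin ((n + 1/2) t) - sin ((n - 1/2) t). The product form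
    stays valid at t = 0. *)
Lemma sin_mult_dirichlet_kernel (N : nat) (t : R) :
  sin (t / 2) * dirichlet_kernel N t = sin ((INR N + / 2) * t).
Proof.
  unfold dirichlet_kernel. induction N as [|N IH].
  - rewrite sum_O; simpl. rewrite Rmult_0_l, cos_0.
    replace ((0 + / 2) * t) with (t / 2) by field. ring.
  - rewrite sum_Sn_R, Rmult_plus_distr_l, IH, S_INR. unfold fold_weight.
    replace ((INR N + / 2) * t) with ((INR N + 1) * t - t / 2) by field.
    replace ((INR N + 1 + / 2) * t) with ((INR N + 1) * t + t / 2) by field.
    rewrite sin_minus, sin_plus. ring.
Qed.

Lemma sin_INR_PI (n : nat) : sin (INR n * PI) = 0.
Proof. apply sin_eq_0_1. exists (Z.of_nat n). now rewrite INR_IZR_INZ. Qed.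

Lemma cos_INR_PI (n : nat) : cos (INR n * PI) = (-1) ^ n.
Proof.
  induction n as [|n IH]; [simpl; now rewrite Rmult_0_l, cos_0|].
  rewrite S_INR, Rmult_plus_distr_r, Rmult_1_l, neg_cos, IH. simpl; ring.
Qed.

Lemma is_RInt_cosh_cos (y : R) (n : nat) : y <> 0 ->
  is_RInt (fun t => cosh (y * t) * cos (INR n * t)) 0 PI
    (sinh (PI * y) * ((-1) ^ n * (y / (y * y + INR n * INR n)))).
Proof.
  intros Hy.
  assert (Hd : y * y + INR n * INR n <> 0) by nra.
  (* The antiderivative given by two integrations by parts. At [PI] the sine vanishes and the cosine
     is (-1)^n, which is where the alternating sign originates; at 0 everything vanishes. *)
  pose (F := fun t => (y * sinh (y * t) * cos (INR n * t)
                       + INR n * cosh (y * t) * sin (INR n * t))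
                      / (y * y + INR n * INR n)).
  replace (sinh (PI * y) * _) with (minus (F PI) (F 0)).
  2:{ unfold F, minus, plus, opp; simpl.
      rewrite sin_INR_PI, cos_INR_PI, !Rmult_0_r, sinh_0, sin_0, (Rmult_comm y PI).
      field; exact Hd. }
  apply (is_RInt_derive F).
  - intros t _. unfold F, sinh, cosh. auto_derive; [easy|]. field; exact Hd.
  - intros t _. apply (ex_derive_continuous (V := R_NormedModule)).
    unfold cosh. auto_derive. easy.
Qed.

Lemma is_RInt_cos (n : nat) :
  is_RInt (fun t => cos (INR (S n) * t)) 0 PI 0.
Proof.
  assert (Hd : INR (S n) <> 0) by now apply not_0_INR.
  pose (F := fun t => sin (INR (S n) * t) / INR (S n)).
  replace 0 with (minus (F PI) (F 0)) at 2.
  2:{ unfold F, minus, plus, opp; cbn -[INR].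
      rewrite sin_INR_PI, !Rmult_0_r, sin_0. field; exact Hd. }
  apply (is_RInt_derive F).
  - intros t _. unfold F. generalize (INR (S n)) Hd; intros c Hc. auto_derive; [easy|]. field; exact Hc.
  - intros t _. apply (ex_derive_continuous (V := R_NormedModule)). auto_derive. easy.
Qed.

Lemma is_RInt_cosh_dirichlet_kernel (y : R) (N : nat) : y <> 0 ->
  is_RInt (fun t => cosh (y * t) * dirichlet_kernel N t) 0 PI
    (sinh (PI * y) *
     sum_n (fun n => fold_weight n * ((-1) ^ n * (y / (y * y + INR n * INR n)))) N).
Proof.
  intros Hy. unfold dirichlet_kernel. induction N as [|N IH].
  - rewrite sum_O. unfold fold_weight at 1. rewrite Rmult_1_l.
    eapply is_RInt_ext, (is_RInt_cosh_cos y 0 Hy).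
    intros t _. rewrite sum_O. unfold fold_weight. eq_at R; ring.
  - rewrite sum_Sn.
    eapply is_RInt_ext.
    2:{ replace (sinh (PI * y) * _) with
          (plus (sinh (PI * y) *
            sum_n (fun n => fold_weight n * ((-1) ^ n * (y / (y * y + INR n * INR n)))) N)
           (scal 2 (sinh (PI * y) *
              ((-1) ^ (S N) * (y / (y * y + INR (S N) * INR (S N))))))).
        - apply (is_RInt_plus (V := R_NormedModule)); [exact IH|].
          apply (is_RInt_scal (V := R_NormedModule)), (is_RInt_cosh_cos y (S N) Hy).
        - unfold plus, scal; cbn -[INR sum_n pow fold_weight].
          unfold mult; cbn -[INR sum_n pow fold_weight]. unfold fold_weight at 3. ring. }
    intros t _. rewrite sum_Sn. unfold plus, scal; cbn -[INR sum_n].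
    unfold mult; cbn -[INR sum_n]. ring.
Qed.

(** Only the constant term of the kernel has a nonzero integral. This allows the value cosh 0 = 1 to
    be subtracted under the integral sign. *)
Lemma is_RInt_dirichlet_kernel (N : nat) : is_RInt (dirichlet_kernel N) 0 PI PI.
Proof.
  unfold dirichlet_kernel. induction N as [|N IH].
  - apply (is_RInt_ext (fun _ => 1)).
    + intros t _. rewrite sum_O. simpl. rewrite Rmult_0_l, cos_0. ring.
    + pose proof (is_RInt_const (V := R_NormedModule) 0 PI 1) as H.
      unfold scal in H; simpl in H; unfold mult in H; simpl in H.
      now replace ((PI - 0) * 1) with PI in H by ring.
  - replace PI with (plus PI (scal 2 0)) at 2.
    2:{ unfold plus, scal; simpl. unfold mult; simpl. ring. }
    eapply is_RInt_ext.
    2:{ apply (is_RInt_plus (V := R_NormedModule)); [exact IH|].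
        apply (is_RInt_scal (V := R_NormedModule)), (is_RInt_cos N). }
    intros t _. rewrite sum_Sn. unfold plus, scal; cbn -[INR sum_n].
    unfold mult; cbn -[INR sum_n]. reflexivity.
Qed.

Lemma continuous_dirichlet_kernel (N : nat) (t : R) : continuous (dirichlet_kernel N) t.
Proof.
  unfold dirichlet_kernel. induction N as [|N IH].
  - apply (continuous_ext (fun t => fold_weight 0 * cos (INR 0 * t))).
    + intros s. now rewrite sum_O.
    + apply (ex_derive_continuous (V := R_NormedModule)). auto_derive. easy.
  - apply (continuous_ext (fun t => plus
       (sum_n (fun n => fold_weight n * cos (INR n * t)) N)
       (fold_weight (S N) * cos (INR (S N) * t)))).
    + intros s. now rewrite sum_Sn.
    + apply (continuous_plus (V := R_NormedModule)); [exact IH|].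
      apply (ex_derive_continuous (V := R_NormedModule)). auto_derive. easy.
Qed.

(* Near 0 the numerator vanishes to second order and the denominator to first,
   so the quotient stays bounded uniformly in N. *)
Lemma cosh_dirichlet_kernel_bound (y : R) : exists d : R, 0 < d /\
  forall (N : nat) (t : R), 0 <= t <= d ->
    Rabs ((cosh (y * t) - 1) * dirichlet_kernel N t) <= 4.
Proof.
  assert (H1 : is_derive (fun t => cosh (y * t)) 0 0).
  { unfold cosh. auto_derive; [easy|]. rewrite Rmult_0_r, Ropp_0, exp_0. field. }
  assert (H2 : is_derive (fun t => sin (t / 2)) 0 (/ 2)).
  { auto_derive; [easy|]. unfold Rdiv. rewrite Rmult_0_l, cos_0. field. }
  apply is_derive_Reals in H1. apply is_derive_Reals in H2.
  (* Tolerance 1 around the derivative 0 gives |cosh (y t) - 1| <= t, and tolerance 1/4 around the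
     derivative 1/2 gives sin (t/2) >= t/4. Their quotient is the bound 4. *)
  destruct (H1 1 Rlt_0_1) as [d1 K1].
  assert (H4 : 0 < / 4) by lra.
  destruct (H2 (/ 4) H4) as [d2 K2].
  pose proof (cond_pos d1). pose proof (cond_pos d2).
  exists (Rmin d1 d2 / 2). pose proof (Rmin_l d1 d2). pose proof (Rmin_r d1 d2).
  assert (Hm : 0 < Rmin d1 d2) by (apply Rmin_glb_lt; assumption).
  split; [lra|]. intros N t [Ht0 Ht1].
  destruct Ht0 as [Ht0|<-].
  2:{ rewrite Rmult_0_r, cosh_0, Rminus_diag, Rmult_0_l, Rabs_R0. lra. }
  assert (Htn : t <> 0) by lra.
  assert (Ha : Rabs t = t) by (apply Rabs_right; lra).
  assert (K1' : Rabs (cosh (y * t) - 1) <= t).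
  { specialize (K1 t Htn). rewrite Ha in K1. specialize (K1 ltac:(lra)).
    rewrite Rplus_0_l, Rmult_0_r, cosh_0, Rminus_0_r in K1.
    rewrite Rabs_div, Ha in K1 by assumption.
    apply Rmult_lt_compat_r with (r := t) in K1; [|assumption].
    unfold Rdiv in K1. rewrite Rmult_assoc, Rinv_l in K1 by assumption. lra. }
  assert (K2' : t / 4 <= sin (t / 2)).
  { specialize (K2 t Htn). rewrite Ha in K2. specialize (K2 ltac:(lra)).
    unfold Rdiv in K2. rewrite Rplus_0_l, Rmult_0_l, sin_0, Rminus_0_r in K2.
    apply Rabs_def2 in K2. destruct K2 as [_ K2].
    apply Rmult_lt_compat_r with (r := t) in K2; [|assumption].
    rewrite Rmult_minus_distr_r, Rmult_assoc, Rinv_l in K2 by assumption.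
    unfold Rdiv. lra. }
  pose proof (sin_mult_dirichlet_kernel N t) as E.
  assert (K3 : Rabs (sin (t / 2)) * Rabs (dirichlet_kernel N t) <= 1).
  { rewrite <- Rabs_mult, E. apply Rabs_le, SIN_bound. }
  rewrite (Rabs_right (sin (t / 2))) in K3 by lra.
  rewrite Rabs_mult. pose proof (Rabs_pos (dirichlet_kernel N t)).
  pose proof (Rabs_pos (cosh (y * t) - 1)). nra.
Qed.

(** * Decay of oscillatory integrals and convergence at t = 0 *)

Lemma continuous_bounded (g : R -> R) (a b : R) : a <= b ->
  (forall t, a <= t <= b -> continuous g t) ->
  exists M, forall t, a <= t <= b -> Rabs (g t) <= M.
Proof.
  intros Hab Hg.
  assert (Hc : forall t, a <= t <= b -> continuity_pt (fun t => Rabs (g t)) t).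
  { intros t Ht. apply continuity_pt_filterlim, continuous_Rabs_comp. now apply Hg. }
  destruct (continuity_ab_maj _ a b Hab Hc) as [M [HM _]].
  exists (Rabs (g M)). exact HM.
Qed.

(** A quantitative Riemann-Lebesgue lemma: one integration by parts gains the factor 1 / w, and [K]
    collects the boundary values of [phi] and a bound for the integral of |[dphi]|, none of which
    depends on w. *)
Lemma RInt_osc_bound (phi dphi : R -> R) (a b : R) : a <= b ->
  (forall t, a <= t <= b -> is_derive phi t (dphi t)) ->
  (forall t, a <= t <= b -> continuous dphi t) ->
  exists K, forall (w I : R), 0 < w ->
    is_RInt (fun t => phi t * sin (w * t)) a b I -> Rabs I <= K / w.
Proof.
  intros Hab Hd Hc.
  destruct (continuous_bounded dphi a b Hab Hc) as [M HM].
  exists (Rabs (phi a) + Rabs (phi b) + M * (b - a)). intros w I Hw HI.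
  (* The derivative of [F] is integrated and w I is added, which isolates the integral of [dphi] t
     cos (w t). *)
  pose (F := fun t => phi t * cos (w * t)).
  assert (HF : is_RInt (fun t => dphi t * cos (w * t) - w * (phi t * sin (w * t))) a b
                 (minus (F b) (F a))).
  { apply (is_RInt_derive F); rewrite Rmin_left, Rmax_right by assumption.
    - intros t Ht. unfold F.
      replace (dphi t * cos (w * t) - w * (phi t * sin (w * t))) with
        (plus (mult (dphi t) (cos (w * t))) (mult (phi t) (- w * sin (w * t))))
        by (unfold plus, mult; simpl; ring).
      apply (is_derive_mult (K := R_AbsRing) phi (fun t => cos (w * t))); [now apply Hd| |intros; apply Rmult_comm].
      auto_derive; [easy|]. ring.
    - intros t Ht. apply (continuous_minus (V := R_NormedModule)).
      + apply (continuous_mult (K := R_AbsRing) dphi (fun t => cos (w * t))); [now apply Hc|].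
        apply (ex_derive_continuous (V := R_NormedModule)). auto_derive. easy.
      + apply (ex_derive_continuous (V := R_NormedModule)).
        apply ex_derive_scal, (ex_derive_mult phi (fun t => sin (w * t))); [now exists (dphi t); apply Hd|]. auto_derive. easy. }
  pose proof (is_RInt_plus _ _ _ _ _ _ HF (is_RInt_scal _ _ _ w _ HI)) as HJ.
  assert (HJ' : is_RInt (fun t => dphi t * cos (w * t)) a b
                  (plus (minus (F b) (F a)) (scal w I))).
  { eapply is_RInt_ext; [|exact HJ]. intros t _. unfold plus, scal; simpl.
    unfold mult; simpl. ring. }
  assert (HB : Rabs (plus (minus (F b) (F a)) (scal w I)) <= (b - a) * M).
  { apply (norm_RInt_le_const (V := R_NormedModule)
             (fun t => dphi t * cos (w * t)) a b); [exact Hab| |exact HJ'].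
    intros t Ht. change (Rabs (dphi t * cos (w * t)) <= M). rewrite Rabs_mult.
    specialize (HM t Ht). pose proof (Rabs_pos (dphi t)).
    assert (Rabs (cos (w * t)) <= 1) by apply Rabs_le, COS_bound.
    pose proof (Rabs_pos (cos (w * t))). nra. }
  assert (Hcos : forall t, Rabs (F t) <= Rabs (phi t)).
  { intros t. unfold F. rewrite Rabs_mult.
    assert (Rabs (cos (w * t)) <= 1) by apply Rabs_le, COS_bound.
    pose proof (Rabs_pos (phi t)). nra. }
  assert (HwI : w * Rabs I <= Rabs (phi a) + Rabs (phi b) + M * (b - a)).
  { rewrite <- (Rabs_right w) at 1 by lra. rewrite <- Rabs_mult.
    replace (w * I) with ((plus (minus (F b) (F a)) (scal w I)) + (F a - F b))
      by (unfold minus, plus, opp, scal; simpl; unfold mult; simpl; ring).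
    eapply Rle_trans; [apply Rabs_triang|].
    assert (Rabs (F a - F b) <= Rabs (F a) + Rabs (F b)).
    { unfold Rminus. eapply Rle_trans; [apply Rabs_triang|]. rewrite Rabs_Ropp. lra. }
    pose proof (Hcos a). pose proof (Hcos b). lra. }
  apply Rmult_le_reg_l with w; [assumption|].
  replace (w * ((Rabs (phi a) + Rabs (phi b) + M * (b - a)) / w)) with
    (Rabs (phi a) + Rabs (phi b) + M * (b - a)) by (field; lra). exact HwI.
Qed.

Lemma is_lim_seq_cosh_dirichlet_kernel (y : R) (I : nat -> R) :
  (forall N, is_RInt (fun t => (cosh (y * t) - 1) * dirichlet_kernel N t) 0 PI (I N)) ->
  is_lim_seq I 0.
Proof.
  intros HI. apply is_lim_seq_spec. intros eps. pose proof (cond_pos eps) as Heps.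
  destruct (cosh_dirichlet_kernel_bound y) as [d [Hd Hb]].
  (* With the integrand bounded by 4, the piece on [0, e] contributes at most 4 e <= eps / 4; the
     piece on [e, PI] will contribute less than eps / 2. *)
  pose (e := Rmin (Rmin d PI) (eps / 16)). pose proof PI_RGT_0 as HPI.
  assert (He : 0 < e /\ e <= d /\ e <= PI /\ e <= eps / 16).
  { unfold e. pose proof (Rmin_l (Rmin d PI) (eps / 16)).
    pose proof (Rmin_r (Rmin d PI) (eps / 16)).
    pose proof (Rmin_l d PI). pose proof (Rmin_r d PI).
    repeat split; try lra. repeat apply Rmin_glb_lt; lra. }
  destruct He as [He0 [Hed [HePI Hee]]].
  pose (phi := fun t => (cosh (y * t) - 1) / sin (t / 2)).
  pose (dphi := fun t => (y * sinh (y * t) * sin (t / 2)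
                          - (cosh (y * t) - 1) * (cos (t / 2) / 2)) / (sin (t / 2)) ^ 2).
  assert (Hsin : forall t, e <= t <= PI -> sin (t / 2) <> 0).
  { intros t Ht. apply Rgt_not_eq, sin_gt_0; lra. }
  destruct (RInt_osc_bound phi dphi e PI HePI) as [K HK].
  { intros t Ht. specialize (Hsin t Ht). unfold phi, dphi, cosh, sinh.
    auto_derive; [easy|]. change (t * / 2) with (t / 2). field. easy. }
  { intros t Ht. specialize (Hsin t Ht). apply (ex_derive_continuous (V := R_NormedModule)).
    unfold dphi, cosh, sinh. auto_derive. simpl. rewrite Rmult_1_r.
    now apply Rmult_integral_contrapositive. }
  (* Beyond this index 2 K / eps < N + 1/2. The absolute value is there because the sign of [K] is
     not known and the floor takes a nonnegative argument. *)
  destruct (nfloor_ex (Rabs (2 * K / eps)) (Rabs_pos _)) as [N0 [_ HN0]].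
  exists (S N0). intros N HN. rewrite Rminus_0_r.
  assert (Hcont : forall t, continuous (fun t => (cosh (y * t) - 1) * dirichlet_kernel N t) t).
  { intros t. apply (continuous_mult (K := R_AbsRing)).
    - apply (ex_derive_continuous (V := R_NormedModule)). unfold cosh. auto_derive. easy.
    - apply continuous_dirichlet_kernel. }
  assert (Hex : forall u v, ex_RInt (fun t => (cosh (y * t) - 1) * dirichlet_kernel N t) u v).
  { intros u v. apply (ex_RInt_continuous (V := R_CompleteNormedModule)). intros; apply Hcont. }
  destruct (Hex 0 e) as [I1 H1]. destruct (Hex e PI) as [I2 H2].
  pose proof (is_RInt_Chasles _ _ _ _ _ _ H1 H2) as H3.
  assert (EI : I N = I1 + I2).
  { rewrite <- (is_RInt_unique _ _ _ _ (HI N)). now apply is_RInt_unique. }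
  assert (B1 : Rabs I1 <= (e - 0) * 4).
  { apply (norm_RInt_le_const (V := R_NormedModule)
       (fun t => (cosh (y * t) - 1) * dirichlet_kernel N t) 0 e); [lra| |exact H1].
    intros t Ht. apply Hb. lra. }
  assert (Hw : 0 < INR N + / 2) by (pose proof (pos_INR N); lra).
  assert (B2 : Rabs I2 <= K / (INR N + / 2)).
  { apply HK; [exact Hw|]. eapply is_RInt_ext; [|exact H2].
    rewrite Rmin_left, Rmax_right by assumption. intros t Ht.
    rewrite <- sin_mult_dirichlet_kernel. unfold phi. eq_at R. field. apply Hsin; lra. }
  assert (B3 : K / (INR N + / 2) < eps / 2).
  { apply Rmult_lt_reg_r with (INR N + / 2); [exact Hw|].
    unfold Rdiv at 1. rewrite Rmult_assoc, Rinv_l, Rmult_1_r by lra.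
    apply le_INR in HN. rewrite S_INR in HN. pose proof (Rle_abs (2 * K / eps)) as HA.
    assert (HB : 2 * K / eps < INR N + / 2) by lra.
    apply Rmult_lt_compat_r with (r := eps / 2) in HB; [|lra].
    replace (2 * K / eps * (eps / 2)) with K in HB by (field; lra). lra. }
  rewrite EI. pose proof (Rabs_triang I1 I2). lra.
Qed.

Lemma sinh_neq_0 (x : R) : x <> 0 -> sinh x <> 0.
Proof.
  intros Hx H. destruct (Rdichotomy _ _ Hx) as [Hl|Hl].
  - apply sinh_lt in Hl. rewrite sinh_0 in Hl. lra.
  - apply sinh_lt in Hl. rewrite sinh_0 in Hl. lra.
Qed.

(** Subtracting the integral of the kernel from that of cosh (y t) times the kernel identifies sinh
    (PI y) [A] N - PI with a sequence already known to tend to 0; it remains to divide by sinh (PI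
    y). *)
Lemma is_series_csch (y : R) : y <> 0 ->
  is_series (fun n => fold_weight n * ((-1) ^ n * (y / (y * y + INR n * INR n))))
    (PI / sinh (PI * y)).
Proof.
  intros Hy.
  assert (Hs : sinh (PI * y) <> 0).
  { apply sinh_neq_0. pose proof PI_RGT_0. apply Rmult_integral_contrapositive; split; lra. }
  set (A := fun N => sum_n (fun n => fold_weight n *
                      ((-1) ^ n * (y / (y * y + INR n * INR n)))) N).
  assert (H : is_lim_seq (fun N => sinh (PI * y) * A N - PI) 0).
  { apply (is_lim_seq_cosh_dirichlet_kernel y). intros N.
    pose proof (is_RInt_minus _ _ _ _ _ _ (is_RInt_cosh_dirichlet_kernel y N Hy)
      (is_RInt_dirichlet_kernel N)) as K.
    eapply is_RInt_ext; [|exact K].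
    intros t _. unfold minus, plus, opp; simpl. ring. }
  change (is_lim_seq A (PI / sinh (PI * y))).
  apply is_lim_seq_ext with (fun N => / sinh (PI * y) * ((sinh (PI * y) * A N - PI) + PI)).
  { intros N. field. exact Hs. }
  replace (Finite (PI / sinh (PI * y))) with (Rbar_mult (/ sinh (PI * y)) (0 + PI)).
  2:{ simpl. f_equal. field. exact Hs. }
  apply is_lim_seq_scal_l. apply is_lim_seq_plus'; [exact H|apply is_lim_seq_const].
Qed.

(** * Termwise differentiation *)

(** Since n + 2 <= 2 (n + 1), the bound 1 / (n+1)^2 is at most 2 (1 / (n+1) - 1 / (n+2)), which
    telescopes. The term [u 0] is left free: for the folded series it is y^-p, which is unbounded
    near y = 0. *)
Lemma sum_n_tail_bound (u : nat -> R) (K : R) (N d : nat) : 0 <= K ->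
  (forall n, Rabs (u (S n)) <= K / (INR n + 1) ^ 2) ->
  Rabs (sum_n u (N + d) - sum_n u N) <= 2 * K * (/ (INR N + 1) - / (INR (N + d) + 1)).
Proof.
  intros HK Hu. induction d as [|d IH].
  - rewrite Nat.add_0_r, !Rminus_diag, Rabs_R0. lra.
  - rewrite Nat.add_succ_r, sum_Sn_R.
    set (n := (N + d)%nat) in *. specialize (Hu n).
    pose proof (pos_INR n) as Hn. rewrite S_INR.
    replace (sum_n u n + u (S n) - sum_n u N) with
      ((sum_n u n - sum_n u N) + u (S n)) by ring.
    eapply Rle_trans; [apply Rabs_triang|].
    assert (E : K / (INR n + 1) ^ 2 <= 2 * K * (/ (INR n + 1) - / (INR n + 1 + 1))).
    { apply Rminus_le.
      replace (K / (INR n + 1) ^ 2 - 2 * K * (/ (INR n + 1) - / (INR n + 1 + 1))) with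
        (- (K * INR n / ((INR n + 1) ^ 2 * (INR n + 1 + 1)))) by (field; lra).
      assert (0 <= K * INR n / ((INR n + 1) ^ 2 * (INR n + 1 + 1))); [|lra].
      apply Rmult_le_pos; [nra|]. apply Rlt_le, Rinv_0_lt_compat.
      apply Rmult_lt_0_compat; [apply pow_lt|]; lra. }
    lra.
Qed.

Lemma is_lim_seq_inv_INR (K : R) : is_lim_seq (fun N => K / (INR N + 1)) 0.
Proof.
  replace (Finite 0) with (Rbar_mult K 0) by (simpl; f_equal; ring).
  apply (is_lim_seq_scal_l (fun N => / (INR N + 1)) K 0).
  apply (is_lim_seq_ext (fun N => / INR (S N))); [intros; now rewrite S_INR|].
  apply (is_lim_seq_incr_1 (fun N => / INR N)).
  apply (is_lim_seq_inv INR p_infty); [apply is_lim_seq_INR|discriminate].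
Qed.

Lemma ex_series_inv_sq (u : nat -> R) (K : R) : 0 <= K ->
  (forall n, Rabs (u (S n)) <= K / (INR n + 1) ^ 2) -> ex_series u.
Proof.
  intros HK Hu.
  assert (H : ex_finite_lim_seq (sum_n u)); [|destruct H as [l Hl]; now exists l].
  apply ex_lim_seq_cauchy_corr. intros eps.
  pose proof (is_lim_seq_inv_INR (2 * K)) as H. apply is_lim_seq_spec in H.
  assert (He : 0 < eps / 2) by (pose proof (cond_pos eps); lra).
  destruct (H (mkposreal _ He)) as [N HN]; simpl in HN.
  specialize (HN N (Nat.le_refl N)). rewrite Rminus_0_r in HN.
  assert (HB : forall n, (N <= n)%nat -> Rabs (sum_n u n - sum_n u N) < eps / 2).
  { intros n Hn. replace n with (N + (n - N))%nat by lia.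
    eapply Rle_lt_trans; [now apply sum_n_tail_bound with (K := K)|].
    eapply Rle_lt_trans; [|exact HN]. eapply Rle_trans; [|apply Rle_abs].
    unfold Rdiv. rewrite Rmult_minus_distr_l.
    pose proof (pos_INR (N + (n - N))) as Hp.
    assert (0 < / (INR (N + (n - N)) + 1)) by (apply Rinv_0_lt_compat; lra). nra. }
  exists N. intros n m Hn Hm.
  replace (sum_n u n - sum_n u m) with
    ((sum_n u n - sum_n u N) - (sum_n u m - sum_n u N)) by ring.
  unfold Rminus at 1. eapply Rle_lt_trans; [apply Rabs_triang|]. rewrite Rabs_Ropp.
  pose proof (HB n Hn). pose proof (HB m Hm). lra.
Qed.

(** The right-hand side involves [u] only through [K], so a family of series sharing the same [K]
    converges uniformly. *)
Lemma Series_tail_bound (u : nat -> R) (K : R) (N : nat) : 0 <= K ->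
  (forall n, Rabs (u (S n)) <= K / (INR n + 1) ^ 2) ->
  Rabs (Series u - sum_n u N) <= 2 * K / (INR N + 1).
Proof.
  intros HK Hu.
  pose proof (Series_correct u (ex_series_inv_sq u K HK Hu)) as H.
  change (is_lim_seq (sum_n u) (Series u)) in H.
  assert (H1 : is_lim_seq (fun n => Rabs (sum_n u n - sum_n u N))
                 (Rabs (Series u - sum_n u N))).
  { apply (is_lim_seq_abs _ (Finite (Series u - sum_n u N))).
    apply is_lim_seq_minus'; [exact H|apply is_lim_seq_const]. }
  change (Rbar_le (Rabs (Series u - sum_n u N)) (2 * K / (INR N + 1))).
  apply is_lim_seq_le_loc with (2 := H1) (3 := is_lim_seq_const _).
  exists N. intros n Hn. replace n with (N + (n - N))%nat by lia.
  eapply Rle_trans; [now apply sum_n_tail_bound with (K := K)|].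
  unfold Rdiv. rewrite Rmult_minus_distr_l.
  pose proof (pos_INR (N + (n - N))) as Hp.
  assert (0 < / (INR (N + (n - N)) + 1)) by (apply Rinv_0_lt_compat; lra). nra.
Qed.

(** This is the derivative of z^-p along a horizontal line. Both parts go through the induction
    together because multiplication by 1 / z mixes them. *)
Lemma is_derive_inv_pow (p : nat) (c y : R) : y * y + c * c <> 0 ->
  is_derive (fun y => Re ((/ (y, c)) ^ p)%C) y (- INR p * Re ((/ (y, c)) ^ S p)%C) /\
  is_derive (fun y => Im ((/ (y, c)) ^ p)%C) y (- INR p * Im ((/ (y, c)) ^ S p)%C).
Proof.
  intros Hy. induction p as [|p [IHr IHi]].
  - simpl INR. rewrite Ropp_0, !Rmult_0_l.
    split; apply is_derive_Reals;
      [exact (derivable_pt_lim_const 1 y)|exact (derivable_pt_lim_const 0 y)].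
  (* [u] and [v] are the real and imaginary parts of 1 / z with z = y + c i; [Hu] and [Hv] below say
     that (1 / z)' = - (1 / z)^2. *)
  - pose (u := fun y => y / (y ^ 2 + c ^ 2)). pose (v := fun y => - c / (y ^ 2 + c ^ 2)).
    assert (Hy2 : y ^ 2 + c ^ 2 <> 0) by (intros E; apply Hy; rewrite <- E; ring).
    assert (Hu : is_derive u y (- (u y * u y - v y * v y))).
    { unfold u, v. auto_derive; [now replace (y * (y * 1) + c * (c * 1)) with (y ^ 2 + c ^ 2) by ring|].
      field. easy. }
    assert (Hv : is_derive v y (- (2 * u y * v y))).
    { unfold u, v. auto_derive; [now replace (y * (y * 1) + c * (c * 1)) with (y ^ 2 + c ^ 2) by ring|].
      field. easy. }
    pose (P := fun p y => Re ((/ (y, c)) ^ p)%C). pose (Q := fun p y => Im ((/ (y, c)) ^ p)%C).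
    change (is_derive (P p) y (- INR p * P (S p) y)) in IHr.
    change (is_derive (Q p) y (- INR p * Q (S p) y)) in IHi.
    assert (EP : forall p y, P (S p) y = u y * P p y - v y * Q p y) by reflexivity.
    assert (EQ : forall p y, Q (S p) y = u y * Q p y + v y * P p y) by reflexivity.
    change (is_derive (fun y => u y * P p y - v y * Q p y) y (- INR (S p) * P (S (S p)) y) /\
            is_derive (fun y => u y * Q p y + v y * P p y) y (- INR (S p) * Q (S (S p)) y)).
    rewrite (EP (S p)), (EQ (S p)), S_INR. rewrite EP in IHr. rewrite EQ in IHi.
    rewrite !EP, !EQ.
    clearbody u v P Q.
    apply is_derive_Reals in IHr, IHi, Hu, Hv. split; apply is_derive_Reals.
    + pose proof (derivable_pt_lim_minus _ _ _ _ _ (derivable_pt_lim_mult _ _ _ _ _ Hu IHr)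
        (derivable_pt_lim_mult _ _ _ _ _ Hv IHi)) as H.
      match type of H with derivable_pt_lim _ _ ?l =>
        replace l with (- (INR p + 1) *
          (u y * (u y * P p y - v y * Q p y) - v y * (u y * Q p y + v y * P p y))) in H by ring end.
      exact H.
    + pose proof (derivable_pt_lim_plus _ _ _ _ _ (derivable_pt_lim_mult _ _ _ _ _ Hu IHi)
        (derivable_pt_lim_mult _ _ _ _ _ Hv IHr)) as H.
      match type of H with derivable_pt_lim _ _ ?l =>
        replace l with (- (INR p + 1) *
          (u y * (u y * Q p y + v y * P p y) + v y * (u y * P p y - v y * Q p y))) in H by ring end.
      exact H.
Qed.

Lemma pair_neq_0 (y c : R) : y * y + c * c <> 0 -> (y, c) <> RtoC 0.
Proof. intros H E. apply H. injection E as -> ->. ring. Qed.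

(** As |y + (n+1) i| >= n + 1 >= 1, two factors supply the inverse square and the other p are at
    most 1. The bound is independent of y. *)
Lemma Cmod_inv_pow_le (p n : nat) (y : R) :
  Cmod ((/ (y, INR (S n))) ^ (S (S p)))%C <= 1 / (INR n + 1) ^ 2.
Proof.
  assert (Hn : 1 <= INR (S n)) by (rewrite S_INR; pose proof (pos_INR n); lra).
  assert (Hz : (y, INR (S n)) <> RtoC 0) by (apply pair_neq_0; nra).
  rewrite Cmod_pow, Cmod_inv by exact Hz. rewrite <- S_INR.
  assert (HM : INR (S n) <= Cmod (y, INR (S n))).
  { eapply Rle_trans; [|apply (Rmax_Cmod (y, INR (S n)))].
    eapply Rle_trans; [|apply Rmax_r]. apply Rle_abs. }
  set (z := Cmod _) in *. set (w := INR (S n)) in *.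
  assert (Hi : / z <= / w) by (apply Rinv_le_contravar; lra).
  assert (Hw : / w <= 1) by (rewrite <- Rinv_1; apply Rinv_le_contravar; lra).
  assert (Hz0 : 0 < / z) by (apply Rinv_0_lt_compat; lra).
  assert (Hp : (/ z) ^ p <= 1) by (rewrite <- (pow1 p); apply pow_incr; lra).
  assert (Hp0 : 0 <= (/ z) ^ p) by (apply pow_le; lra).
  replace (1 / w ^ 2) with (/ w * / w) by (field; lra).
  simpl. apply Rle_trans with (/ z * (/ z * 1)).
  - apply Rmult_le_compat_l; [lra|]. apply Rmult_le_compat_l; lra.
  - rewrite Rmult_1_r. apply Rmult_le_compat; lra.
Qed.

(* The terms of index n and -n of the symmetric sum of (-1)^n / (y + n i)^p,
   folded together. *)
Definition folded_term (p : nat) (y : R) (n : nat) : R :=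
  fold_weight n * ((-1) ^ n * Re ((/ (y, INR n)) ^ p)%C).

Lemma folded_term_bound (p n : nat) (y : R) :
  Rabs (folded_term (S (S p)) y (S n)) <= 2 / (INR n + 1) ^ 2.
Proof.
  unfold folded_term. rewrite !Rabs_mult, pow_1_abs, Rmult_1_l.
  unfold fold_weight. rewrite Rabs_right by lra.
  pose proof (re_le_Cmod ((/ (y, INR (S n))) ^ S (S p))%C).
  pose proof (Cmod_inv_pow_le p n y). lra.
Qed.

Lemma is_derive_folded_term (p n : nat) (y : R) : y <> 0 ->
  is_derive (fun y => folded_term p y n) y (- INR p * folded_term (S p) y n).
Proof.
  intros Hy. assert (Hd : y * y + INR n * INR n <> 0) by nra.
  destruct (is_derive_inv_pow p (INR n) y Hd) as [H _].
  unfold folded_term.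
  replace (- INR p * _) with
    (fold_weight n * ((-1) ^ n * (- INR p * Re ((/ (y, INR n)) ^ S p)%C))) by ring.
  apply is_derive_scal, is_derive_scal, H.
Qed.

Lemma is_derive_sum_folded_term (p N : nat) (y : R) : y <> 0 ->
  is_derive (fun y => sum_n (folded_term p y) N) y
    (- INR p * sum_n (folded_term (S p) y) N).
Proof.
  intros Hy. rewrite <- (sum_n_mult_l (K := R_AbsRing) (- INR p)).
  apply (is_derive_sum_n (K := R_AbsRing) (V := R_NormedModule) (fun n y => folded_term p y n)).
  intros n _. now apply is_derive_folded_term.
Qed.

(** The series of derivatives has exponent at least 2 and converges uniformly, so its sum times -
    (p+1) is the derivative of G; uniqueness of derivatives then identifies it with D. *)
Lemma is_series_folded_term_step (p : nat) (G : R -> R) (y D : R) : y <> 0 ->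
  (forall z, z <> 0 -> is_series (folded_term (S p) z) (G z)) ->
  is_derive G y D ->
  is_series (folded_term (S (S p)) y) (- D / INR (S p)).
Proof.
  intros Hy HG HD.
  assert (H2 : 0 <= 2) by lra.
  pose (H := fun z => Series (folded_term (S (S p)) z)).
  assert (HH : forall z, is_series (folded_term (S (S p)) z) (H z)).
  { intros z. apply Series_correct, ex_series_inv_sq with 2; [exact H2|].
    intros n. apply folded_term_bound. }
  (* A ball of radius |y| / 2 around y stays away from the pole at 0. *)
  assert (Hr : 0 < Rabs y / 2) by (apply Rabs_pos_lt in Hy; lra).
  pose (r := mkposreal _ Hr).
  assert (Hb : forall z, Boule y r z -> z <> 0).
  { intros z Hz ->. unfold Boule in Hz; simpl in Hz. rewrite Rminus_0_l, Rabs_Ropp in Hz. lra. }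
  assert (Hp : INR (S p) <> 0) by now apply not_0_INR.
  assert (Hp0 : 0 < INR (S p)) by (apply lt_0_INR; lia).
  assert (HC : CVU (fun N z => - INR (S p) * sum_n (folded_term (S (S p)) z) N)
                 (fun z => - INR (S p) * H z) y r).
  { intros eps Heps.
    (* The tail bound 2 K / (N + 1) with K = 2, times the factor p + 1 from differentiation. *)
    pose proof (is_lim_seq_inv_INR (2 * 2 * INR (S p))) as L. apply is_lim_seq_spec in L.
    destruct (L (mkposreal _ Heps)) as [N HN]. exists N. intros n z Hn _.
    specialize (HN n Hn). rewrite Rminus_0_r in HN. simpl in HN.
    replace (- INR (S p) * H z - _) with
      (- INR (S p) * (H z - sum_n (folded_term (S (S p)) z) n)) by ring.
    rewrite Rabs_mult, Rabs_Ropp, (Rabs_right (INR (S p))) by lra.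
    pose proof (Series_tail_bound (folded_term (S (S p)) z) 2 n H2
      (fun m => folded_term_bound p m z)) as B. fold (H z) in B.
    apply Rmult_le_compat_l with (r := INR (S p)) in B; [|lra].
    eapply Rle_lt_trans; [exact B|]. eapply Rle_lt_trans; [|exact HN].
    eapply Rle_trans; [|apply Rle_abs]. right. unfold Rdiv. simpl INR. ring. }
  assert (HE : derivable_pt_lim G y (- INR (S p) * H y)).
  { apply (Ranalysis5.derivable_pt_lim_CVU
      (fun N z => sum_n (folded_term (S p) z) N)
      (fun N z => - INR (S p) * sum_n (folded_term (S (S p)) z) N)
      G (fun z => - INR (S p) * H z) y y r).
    - apply Boule_center.
    - intros z n Hz. apply is_derive_Reals, is_derive_sum_folded_term. now apply Hb.
    - intros z Hz. apply is_lim_seq_Reals. apply (HG z), Hb, Hz.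
    - exact HC.
    - apply (CVU_continuity _ _ _ _ HC). intros n z Hz.
      apply continuity_pt_filterlim, (ex_derive_continuous (V := R_NormedModule)
        (fun z => - INR (S p) * sum_n (folded_term (S (S p)) z) n)).
      eexists. apply is_derive_scal, is_derive_sum_folded_term. now apply Hb. }
  apply is_derive_Reals in HE.
  assert (ED : D = - INR (S p) * H y).
  { rewrite <- (is_derive_unique _ _ _ HD). now apply is_derive_unique. }
  replace (- D / INR (S p)) with (H y) by (rewrite ED; field; exact Hp). apply HH.
Qed.

(* Closed forms of the (2j)-th derivative of 1/sinh and of the opposite of the
   (2j+1)-th one. *)
Definition csch_even_deriv (j : nat) (x : R) : R :=
  sum_n (fun l => INR (fact (2 * l)) * INR (S_coef j l) * / sinh x ^ (2 * l + 1)) j.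

Definition csch_odd_deriv (j : nat) (x : R) : R :=
  sum_n (fun l => INR (fact (2 * l + 1)) * INR (S_coef j l)
                  * (cosh x / sinh x ^ (2 * l + 2))) j.

(** Each power sinh^-(2l+1) brings down the factor 2l+1, which turns (2l)! into (2l+1)!; the
    coefficients [S_coef j l] do not change. *)
Lemma is_derive_csch_even_deriv (j : nat) (x : R) : x <> 0 ->
  is_derive (csch_even_deriv j) x (- csch_odd_deriv j x).
Proof.
  intros Hx. apply sinh_neq_0 in Hx. unfold csch_even_deriv, csch_odd_deriv.
  rewrite <- (Rmult_1_l (sum_n _ _)), Ropp_mult_distr_l.
  rewrite <- (sum_n_mult_l (K := R_AbsRing) (- (1))).
  apply (is_derive_sum_n (K := R_AbsRing) (V := R_NormedModule)
    (fun l x => INR (fact (2 * l)) * INR (S_coef j l) * / sinh x ^ (2 * l + 1))).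
  intros l _. unfold mult; simpl mult. change (Hierarchy.mult ?u ?v) with (u * v).
  replace (2 * l + 1)%nat with (S (2 * l)) by lia. rewrite fact_simpl, mult_INR.
  set (A := INR (fact (2 * l))). set (B := INR (S_coef j l)).
  replace (2 * l + 2)%nat with (2 + 2 * l)%nat by lia.
  pose proof (is_derive_pow sinh (S (2 * l)) x _ (is_derive_sinh x)) as H.
  apply (is_derive_inv (fun x => sinh x ^ S (2 * l))) in H; [|now apply pow_nonzero].
  apply (is_derive_scal _ _ (A * B)) in H.
  match type of H with is_derive _ _ ?d =>
    replace d with (- (1) * (INR (S (2 * l)) * A * B * (cosh x / sinh x ^ (2 + 2 * l)))) in H end.
  - exact H.
  - rewrite pow_add. change (Init.Nat.pred (S (2 * l))) with (2 * l)%nat. generalize (INR (S (2 * l))); intros c.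
    change (sinh x ^ S (2 * l)) with (sinh x * sinh x ^ (2 * l)). set (s := sinh x ^ (2 * l)).
    assert (s <> 0) by now apply pow_nonzero.
    clearbody s A B. simpl. field. easy.
Qed.

(** Regrouping by powers: [A (S l)] receives S(j,l) from index l and (2l+3)^2 S(j,l+1) from index l
    + 1. The last shifted term has no partner and stays as a boundary term. *)
Lemma sum_S_coef_rec (j i : nat) (A : nat -> R) : (i <= j)%nat ->
  sum_n (fun l => INR (2 * l + 1) ^ 2 * INR (S_coef j l) * A l + INR (S_coef j l) * A (S l)) i
  = sum_n (fun l => INR (S_coef (S j) l) * A l) i + INR (S_coef j i) * A (S i).
Proof.
  induction i as [|i IH]; intros Hi.
  - rewrite !sum_O, !S_coef_0r. simpl. eq_at R; ring.
  - rewrite !sum_Sn_R, IH by lia.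
    replace (2 * S i + 1)%nat with (2 * i + 3)%nat by lia.
    rewrite S_coef_rec by exact Hi.
    rewrite (plus_INR (_ * _ * _)), (mult_INR (_ * _)), (mult_INR (2 * i + 3)). eq_at R; ring.
Qed.

(** By cosh^2 = 1 + sinh^2, the derivative of cosh / sinh^(2l+2) is - (2l+1) sinh^-(2l+1) - (2l+2)
    sinh^-(2l+3). The factor (2l+1)! makes these coefficients (2l+1)^2 (2l)! and (2l+2)!, the two
    terms of the recurrence. *)
Lemma is_derive_csch_odd_deriv (j : nat) (x : R) : x <> 0 ->
  is_derive (csch_odd_deriv j) x (- csch_even_deriv (S j) x).
Proof.
  intros Hx. apply sinh_neq_0 in Hx. unfold csch_even_deriv, csch_odd_deriv.
  pose (A := fun l => INR (fact (2 * l)) * / sinh x ^ (2 * l + 1)).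
  assert (E : sum_n (fun l => INR (fact (2 * l)) * INR (S_coef (S j) l)
                              * / sinh x ^ (2 * l + 1)) (S j)
    = sum_n (fun l => INR (2 * l + 1) ^ 2 * INR (S_coef j l) * A l
                      + INR (S_coef j l) * A (S l)) j).
  { rewrite sum_S_coef_rec by lia.
    (* Both are 1, so the boundary term is the missing summand of index j + 1. *)
    replace (S_coef j j) with (S_coef (S j) (S j)) by now rewrite !S_coef_diag.
    rewrite <- (sum_Sn_R (fun l => INR (S_coef (S j) l) * A l)).
    apply sum_n_ext. intros l. unfold A. eq_at R; ring. }
  rewrite E. rewrite <- (Rmult_1_l (sum_n _ _)), Ropp_mult_distr_l.
  rewrite <- (sum_n_mult_l (K := R_AbsRing) (- (1))).
  apply (is_derive_sum_n (K := R_AbsRing) (V := R_NormedModule)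
    (fun l x => INR (fact (2 * l + 1)) * INR (S_coef j l)
                  * (cosh x / sinh x ^ (2 * l + 2)))).
  intros l _. unfold mult; simpl mult. change (Hierarchy.mult ?u ?v) with (u * v).
  unfold A.
  replace (2 * S l)%nat with (S (S (2 * l))) by lia.
  replace (2 * l + 1)%nat with (S (2 * l)) by lia.
  replace (S (S (2 * l)) + 1)%nat with (3 + 2 * l)%nat by lia.
  replace (2 * l + 2)%nat with (S (S (2 * l))) by lia.
  rewrite !fact_simpl, !mult_INR.
  set (F := INR (fact (2 * l))). set (B := INR (S_coef j l)).
  pose proof (is_derive_pow sinh (S (S (2 * l))) x _ (is_derive_sinh x)) as H.
  apply (is_derive_div cosh (fun x => sinh x ^ S (S (2 * l))) x _ _ (is_derive_cosh x)) in H;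
    [|now apply pow_nonzero].
  apply (is_derive_scal _ _ (INR (S (2 * l)) * F * B)) in H.
  match type of H with is_derive _ _ ?d =>
    match goal with |- is_derive _ _ ?r => replace d with r in H end end.
  - exact H.
  - rewrite pow_add. change (Init.Nat.pred (S (S (2 * l)))) with (S (2 * l)). rewrite (S_INR (S (2 * l))).
    generalize (INR (S (2 * l))); intros c.
    change (sinh x ^ S (S (2 * l))) with (sinh x * (sinh x * sinh x ^ (2 * l))).
    change (sinh x ^ S (2 * l)) with (sinh x * sinh x ^ (2 * l)). set (s := sinh x ^ (2 * l)).
    assert (s <> 0) by now apply pow_nonzero.
    assert (Hc : cosh x * cosh x = 1 + sinh x * sinh x).
    { unfold cosh, sinh. rewrite exp_Ropp. field. apply Rgt_not_eq, exp_pos. }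
    clearbody s F B. simpl. field_simplify; [|easy..].
    replace (cosh x ^ 2) with (1 + sinh x * sinh x) by (rewrite <- Hc; ring).
    field. easy.
Qed.

(** Each differentiation raises the exponent by one: [Hodd] goes from 2j+1 to 2j+2 at the same j,
    and the induction step goes on to 2(j+1)+1. The base case is the expansion of csch. *)
Lemma is_series_folded_term (j : nat) :
  (forall y, y <> 0 -> is_series (folded_term (2 * j + 1) y)
     (PI ^ (2 * j + 1) / INR (fact (2 * j)) * csch_even_deriv j (PI * y))) /\
  (forall y, y <> 0 -> is_series (folded_term (2 * j + 2) y)
     (PI ^ (2 * j + 2) / INR (fact (2 * j + 1)) * csch_odd_deriv j (PI * y))).
Proof.
  assert (Hpy : forall y, y <> 0 -> PI * y <> 0).
  { intros y Hy. pose proof PI_RGT_0. apply Rmult_integral_contrapositive; split; lra. }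
  assert (Hcomp : forall G D c y, is_derive G (PI * y) D ->
            is_derive (fun y => c * G (PI * y)) y (c * (PI * D))).
  { intros G D c y H. apply is_derive_scal.
    apply (is_derive_comp (K := R_AbsRing) (V := R_NormedModule) G (fun y => PI * y) y D PI H).
    auto_derive; [easy|]. ring. }
  assert (Hodd : forall j, (forall y, y <> 0 -> is_series (folded_term (2 * j + 1) y)
     (PI ^ (2 * j + 1) / INR (fact (2 * j)) * csch_even_deriv j (PI * y))) ->
     (forall y, y <> 0 -> is_series (folded_term (2 * j + 2) y)
     (PI ^ (2 * j + 2) / INR (fact (2 * j + 1)) * csch_odd_deriv j (PI * y)))).
  { clear j. intros j H y Hy.
    replace (2 * j + 1)%nat with (S (2 * j)) in * by lia.
    replace (2 * j + 2)%nat with (S (S (2 * j))) by lia.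
    pose proof (is_series_folded_term_step _ _ y _ Hy H
      (Hcomp _ _ _ _ (is_derive_csch_even_deriv j _ (Hpy y Hy)))) as K.
    match type of K with is_series _ ?u =>
      match goal with |- is_series _ ?v => replace v with u end end; [exact K|].
    rewrite fact_simpl, mult_INR.
    rewrite <- (tech_pow_Rmult PI (S (2 * j))). field.
    split; [apply INR_fact_neq_0|now apply not_0_INR]. }
  assert (Heven : forall y, y <> 0 -> is_series (folded_term (2 * j + 1) y)
     (PI ^ (2 * j + 1) / INR (fact (2 * j)) * csch_even_deriv j (PI * y))).
  { induction j as [|j IH].
    - intros y Hy. unfold csch_even_deriv. rewrite sum_O, S_coef_0r. simpl.
      replace (PI * 1 / 1 * (1 * 1 * / (sinh (PI * y) * 1))) with (PI / sinh (PI * y))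
        by (field; now apply sinh_neq_0, Hpy).
      eapply is_series_ext; [|now apply is_series_csch]. intros n.
      unfold folded_term. simpl.
      assert (y * y + INR n * INR n <> 0) by nra.
      eq_at R.
      field. nra.
    - intros y Hy. specialize (Hodd j IH).
      replace (2 * S j + 1)%nat with (S (S (2 * j + 1))) by lia.
      replace (2 * S j)%nat with (S (2 * j + 1)) by lia.
      replace (2 * j + 2)%nat with (S (2 * j + 1)) in Hodd by lia.
      pose proof (is_series_folded_term_step _ _ y _ Hy Hodd
        (Hcomp _ _ _ _ (is_derive_csch_odd_deriv j _ (Hpy y Hy)))) as K.
      match type of K with is_series _ ?u =>
        match goal with |- is_series _ ?v => replace v with u end end; [exact K|].
      rewrite fact_simpl, mult_INR.
      rewrite <- (tech_pow_Rmult PI (S (2 * j + 1))). field.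
      split; [apply INR_fact_neq_0|now apply not_0_INR]. }
  split; [exact Heven|]. now apply Hodd.
Qed.

(** * Symmetric and unordered sums *)

(** Passing from N to N + 1 adds one index at each end; what lies between is the previous sum with
    its index shifted by one. *)
Lemma symmetric_partial_sum (u : Z -> C) (v : nat -> C) :
  u 0%Z = v 0%nat ->
  (forall n, (u (Z.of_nat (S n)) + u (- Z.of_nat (S n))%Z)%C = v (S n)) ->
  forall N, sum_n (G := C_AbelianMonoid) (fun j => u (Z.of_nat j - Z.of_nat N)%Z) (2 * N)%nat
            = sum_n (G := C_AbelianMonoid) v N.
Proof.
  intros H0 HS. induction N as [|N IH].
  - now rewrite !sum_O.
  - rewrite (sum_Sn v), <- IH, <- HS.
    replace (2 * S N)%nat with (S (S (2 * N))) by lia.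
    rewrite sum_Sn. unfold sum_n at 1. rewrite sum_Sn_m by lia. rewrite <- sum_n_m_S.
    fold (sum_n (G := C_AbelianMonoid)
      (fun n => u (Z.of_nat (S n) - Z.of_nat (S N))%Z) (2 * N)).
    rewrite (sum_n_ext _ (fun j => u (Z.of_nat j - Z.of_nat N)%Z)) by (intros; f_equal; lia).
    replace (Z.of_nat (S (S (2 * N))) - Z.of_nat (S N))%Z with (Z.of_nat (S N)) by lia.
    replace (Z.of_nat 0 - Z.of_nat (S N))%Z with (- Z.of_nat (S N))%Z by lia.
    change (@plus C_AbelianMonoid) with Cplus.
    eq_at C. ring.
Qed.

Lemma Cinv_pow_neg_im (y c : R) (p : nat) :
  ((/ (y, (- c)%R)) ^ p)%C = Cconj ((/ (y, c)) ^ p)%C.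
Proof.
  rewrite Cpow_conj. f_equal. unfold Cinv, Cconj; simpl.
  replace (- c * (- c * 1)) with (c * (c * 1)) by ring. f_equal. unfold Rdiv. ring.
Qed.

Lemma powerRZ_m1_nat (n : nat) : powerRZ (-1) (Z.of_nat n) = (-1) ^ n.
Proof. symmetry. apply pow_powerRZ. Qed.

Lemma powerRZ_m1_opp (n : nat) : powerRZ (-1) (- Z.of_nat n) = (-1) ^ n.
Proof.
  rewrite powerRZ_neg' , powerRZ_m1_nat.
  rewrite <- pow_inv by lra. f_equal. field.
Qed.

Lemma sum_n_RtoC (u : nat -> R) (N : nat) :
  sum_n (G := C_AbelianMonoid) (fun n => RtoC (u n)) N = RtoC (sum_n u N).
Proof.
  induction N as [|N IH]; [now rewrite !sum_O|].
  rewrite sum_Sn, IH, sum_Sn_R. symmetry. apply RtoC_plus.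
Qed.

Lemma symmetric_sum_inv_pow (p : nat) (y : R) (N : nat) :
  sum_n (G := C_AbelianMonoid) (fun j =>
     let n := (Z.of_nat j - Z.of_nat N)%Z in
     (RtoC (powerRZ (-1) n) * (/ (y, IZR n)) ^ p)%C) (2 * N)%nat
  = RtoC (sum_n (folded_term p y) N).
Proof.
  rewrite <- sum_n_RtoC. cbv zeta.
  apply (symmetric_partial_sum
    (fun n => (RtoC (powerRZ (-1) n) * (/ (y, IZR n)) ^ p)%C)).
  - unfold folded_term, fold_weight. simpl INR. cbn [powerRZ pow].
    (* At n = 0 the term equals its own conjugate, so its imaginary part vanishes. *)
    pose proof (Cinv_pow_neg_im y 0 p) as E. rewrite Ropp_0 in E.
    destruct ((/ (y, 0)) ^ p)%C as [r i]. injection E as E.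
    assert (i = 0) by lra. subst i. unfold RtoC, Cmult; simpl. f_equal; ring.
  - intros n. rewrite powerRZ_m1_nat, powerRZ_m1_opp, opp_IZR, <- INR_IZR_INZ, Cinv_pow_neg_im.
    unfold folded_term, fold_weight. destruct ((/ (y, INR (S n))) ^ p)%C as [r i].
    generalize ((-1) ^ S n); intros e.
    unfold RtoC, Cmult, Cplus, Cconj; simpl. f_equal; ring.
Qed.

Lemma filterlim_C_scal_RtoC (c : C) (r : nat -> R) (l : R) : is_lim_seq r l ->
  filterlim (fun N => (c * RtoC (r N))%C) eventually
    (locally (T := C_UniformSpace) (c * RtoC l)%C).
Proof.
  intros H. apply (filterlim_locally_ball_norm (K := C_AbsRing) (U := C_NormedModule)).
  intros eps. apply is_lim_seq_spec in H.
  (* The added 1 covers the case c = 0. *)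
  assert (He : 0 < eps / (Cmod c + 1)).
  { apply Rdiv_lt_0_compat; [apply cond_pos|]. pose proof (Cmod_ge_0 c); lra. }
  destruct (H (mkposreal _ He)) as [N HN]. exists N. intros n Hn. specialize (HN n Hn).
  simpl in HN. unfold ball_norm.
  change (Cmod (c * RtoC (r n) - c * RtoC l)%C < eps).
  replace (c * RtoC (r n) - c * RtoC l)%C with (c * RtoC (r n - l))%C
    by (rewrite RtoC_minus; ring).
  rewrite Cmod_mult, Cmod_R. pose proof (Cmod_ge_0 c).
  apply Rmult_lt_compat_r with (r := Cmod c + 1) in HN; [|lra].
  unfold Rdiv in HN. rewrite Rmult_assoc, Rinv_l, Rmult_1_r in HN by lra.
  pose proof (Rabs_pos (r n - l)). nra.
Qed.

(** Factoring m + a n i = a (m/a + n i) reduces to y = m/a and leaves the factor a^-p. *)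
Lemma is_symmetric_sum_inv_pow (c : C) (m : Z) (a s : R) (p : nat) : a <> 0 -> m <> 0%Z ->
  is_series (folded_term p (IZR m / a)) s ->
  is_symmetric_sum
    (fun n => (c * RtoC (powerRZ (-1) n)
               / (RtoC (IZR m) + RtoC a * RtoC (IZR n) * Ci) ^ p)%C)
    (c * RtoC (s / a ^ p))%C.
Proof.
  intros Ha Hm Hs. apply not_0_IZR in Hm. unfold is_symmetric_sum.
  assert (Hap : a ^ p <> 0) by now apply pow_nonzero.
  assert (HaC : RtoC a <> RtoC 0) by (intros E; apply Ha; now apply RtoC_inj).
  replace (c * RtoC (s / a ^ p))%C with (c / RtoC a ^ p * RtoC s)%C.
  2:{ unfold Rdiv. rewrite RtoC_mult, RtoC_inv, RtoC_pow by exact Hap. unfold Cdiv. ring. }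
  eapply filterlim_ext; [|apply (filterlim_C_scal_RtoC _ _ _ Hs)].
  intros N. simpl. rewrite <- symmetric_sum_inv_pow.
  change Cmult with (@mult C_AbsRing). rewrite <- (sum_n_mult_l (K := C_AbsRing)).
  apply sum_n_ext. intros j. cbv zeta. set (n := (Z.of_nat j - Z.of_nat N)%Z).
  change (@mult C_AbsRing) with Cmult.
  assert (Hd : (IZR m / a) * (IZR m / a) + IZR n * IZR n <> 0).
  { assert (IZR m / a <> 0).
    { unfold Rdiv. apply Rmult_integral_contrapositive. split; [exact Hm|now apply Rinv_neq_0_compat]. }
    nra. }
  apply pair_neq_0 in Hd.
  replace (RtoC (IZR m) + RtoC a * RtoC (IZR n) * Ci)%C with (RtoC a * ((IZR m / a)%R, IZR n))%C.
  2:{ unfold RtoC, Ci, Cmult, Cplus; simpl. f_equal; field; exact Ha. }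
  rewrite Cpow_mult_l, Cpow_inv by exact Hd.
  eq_at C.
  field. split; now apply Cpow_nz.
Qed.

(** * Unordered sums over the nonzero integers *)

Lemma NoDup_incl_Permutation {A : Type} (l1 l2 : list A) :
  NoDup l1 -> incl l1 l2 -> exists l, Permutation l2 (l1 ++ l).
Proof.
  revert l2. induction l1 as [|x l1 IH]; intros l2 Hn Hi.
  - now exists l2.
  - inversion_clear Hn as [|? ? Hx Hn1].
    destruct (in_split x l2 (Hi x (or_introl eq_refl))) as [s [t ->]].
    destruct (IH (s ++ t) Hn1) as [l Hl].
    { intros z Hz. specialize (Hi z (or_intror Hz)). apply in_or_app.
      apply in_app_or in Hi. destruct Hi as [Hi|[<-|Hi]]; [now left|contradiction|now right]. }
    exists l. simpl. rewrite <- Hl. symmetry. apply Permutation_middle.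
Qed.

Definition list_Csum (l : list C) : C := fold_right Cplus (RtoC 0) l.
Definition list_Rsum (l : list R) : R := fold_right Rplus 0 l.

Lemma list_Csum_app (l1 l2 : list C) :
  list_Csum (l1 ++ l2) = (list_Csum l1 + list_Csum l2)%C.
Proof. induction l1 as [|x l1 IH]; simpl; [ring|]. rewrite IH. ring. Qed.

Lemma list_Rsum_app (l1 l2 : list R) : list_Rsum (l1 ++ l2) = list_Rsum l1 + list_Rsum l2.
Proof. induction l1 as [|x l1 IH]; simpl; [ring|]. rewrite IH. ring. Qed.

Lemma list_Csum_perm (l1 l2 : list C) : Permutation l1 l2 -> list_Csum l1 = list_Csum l2.
Proof. induction 1; simpl; [easy| |ring|congruence]. now rewrite IHPermutation. Qed.

Lemma list_Rsum_perm (l1 l2 : list R) : Permutation l1 l2 -> list_Rsum l1 = list_Rsum l2.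
Proof. induction 1; simpl; [easy| |ring|congruence]. now rewrite IHPermutation. Qed.

Lemma list_Rsum_Cmod_ge_0 (g : Z -> C) (l : list Z) :
  0 <= list_Rsum (map (fun m => Cmod (g m)) l).
Proof. induction l as [|x l IH]; simpl; [lra|]. pose proof (Cmod_ge_0 (g x)). lra. Qed.

Lemma Cmod_list_Csum_le (g : Z -> C) (l : list Z) :
  Cmod (list_Csum (map g l)) <= list_Rsum (map (fun m => Cmod (g m)) l).
Proof.
  induction l as [|x l IH]; simpl; [rewrite Cmod_0; lra|].
  eapply Rle_trans; [apply Cmod_triangle|]. lra.
Qed.

(** These sets are cofinal among the finite sets of nonzero integers, and their sums are partial
    sums of the series of pairs m, -m. *)
Fixpoint sym_range (N : nat) : list Z :=
  match N with
  | O => nil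
  | S N' => Z.of_nat N :: (- Z.of_nat N)%Z :: sym_range N'
  end.

Lemma in_sym_range (N : nat) (m : Z) :
  In m (sym_range N) <-> m <> 0%Z /\ (Z.abs m <= Z.of_nat N)%Z.
Proof.
  induction N as [|N IH]; [simpl; lia|].
  change (In m (sym_range (S N))) with
    (Z.of_nat (S N) = m \/ (- Z.of_nat (S N))%Z = m \/ In m (sym_range N)).
  rewrite IH. lia.
Qed.

Lemma NoDup_sym_range (N : nat) : NoDup (sym_range N).
Proof.
  induction N as [|N IH]; [constructor|].
  change (NoDup (Z.of_nat (S N) :: (- Z.of_nat (S N))%Z :: sym_range N)).
  constructor; [|constructor; [|exact IH]].
  - intros [H|H]; [lia|]. apply in_sym_range in H. lia.
  - intros H. apply in_sym_range in H. lia.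
Qed.

Lemma list_Csum_sym_range (g : Z -> C) (N : nat) :
  list_Csum (map g (sym_range (S N))) =
  sum_n (G := C_AbelianMonoid)
    (fun j => (g (Z.of_nat (S j)) + g (- Z.of_nat (S j))%Z)%C) N.
Proof.
  induction N as [|N IH].
  - rewrite sum_O. unfold list_Csum. simpl. ring.
  - rewrite sum_Sn, <- IH. change (@plus C_AbelianMonoid) with Cplus.
    change (list_Csum (map g (sym_range (S (S N))))) with
      (g (Z.of_nat (S (S N))) + (g (- Z.of_nat (S (S N)))%Z
        + list_Csum (map g (sym_range (S N)))))%C. ring.
Qed.

Lemma list_Rsum_sym_range (h : Z -> R) (N : nat) :
  list_Rsum (map h (sym_range (S N))) =
  sum_n (fun j => h (Z.of_nat (S j)) + h (- Z.of_nat (S j))%Z) N.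
Proof.
  induction N as [|N IH].
  - rewrite sum_O. unfold list_Rsum. simpl.
    eq_at R. ring.
  - rewrite sum_Sn, <- IH. change (@plus R_AbelianMonoid) with Rplus.
    change (list_Rsum (map h (sym_range (S (S N))))) with
      (h (Z.of_nat (S (S N))) + (h (- Z.of_nat (S (S N)))%Z
        + list_Rsum (map h (sym_range (S N))))).
    eq_at R. ring.
Qed.

Lemma list_abs_bound (L : list Z) :
  exists M : nat, forall m, In m L -> (Z.abs m <= Z.of_nat M)%Z.
Proof.
  induction L as [|x L [M HM]]; [exists O; easy|].
  exists (M + Z.to_nat (Z.abs x))%nat. intros m [<-|H]; [lia|]. specialize (HM m H). lia.
Qed.

(** A finite set containing a large [sym_range] exceeds it by a list [E], on which the absolute
    values have a small sum; the sum over the set is thus close to a partial sum of pairs. *)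
Lemma is_sum_nonzero_abs (g : Z -> C) (s : C) :
  ex_series (fun j => Cmod (g (Z.of_nat (S j))) + Cmod (g (- Z.of_nat (S j))%Z)) ->
  is_series (V := C_NormedModule)
    (fun j => (g (Z.of_nat (S j)) + g (- Z.of_nat (S j))%Z)%C) s ->
  is_sum_nonzero g s.
Proof.
  intros [A HA] Hs eps Heps.
  set (h := fun m => Cmod (g m)).
  change (is_lim_seq (sum_n (fun j => h (Z.of_nat (S j)) + h (- Z.of_nat (S j))%Z)) A) in HA.
  apply is_lim_seq_spec in HA.
  assert (He : 0 < eps / 4) by lra.
  destruct (HA (mkposreal _ He)) as [N1 H1]; cbn [pos] in H1.
  unfold is_series in Hs.
  rewrite (filterlim_locally_ball_norm (K := C_AbsRing) (U := C_NormedModule)) in Hs.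
  assert (He2 : 0 < eps / 2) by lra.
  destruct (Hs (mkposreal _ He2)) as [N2 H2].
  pose (N := (N1 + N2)%nat).
  exists (sym_range (S N)). split; [rewrite in_sym_range; tauto|].
  intros L HL HL0 Hincl. fold (list_Csum (map g L)).
  destruct (NoDup_incl_Permutation _ _ (NoDup_sym_range (S N)) Hincl) as [E HE].
  destruct (list_abs_bound L) as [M0 HM0]. pose (M := (M0 + N)%nat).
  destruct (NoDup_incl_Permutation L (sym_range (S M)) HL) as [E' HE'].
  { intros m Hm. apply in_sym_range. split; [now intros ->|]. specialize (HM0 m Hm).
    unfold M. lia. }
  (* [L] lies in the larger [sym_range (S M)], so the sum over [E] is at most the difference of the
     absolute partial sums at M and N, each within eps / 4 of [A]. *)
  assert (HR : list_Rsum (map h E) < eps / 2).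
  { pose proof (list_Rsum_perm _ _ (Permutation_map h HE')) as P1.
    pose proof (list_Rsum_perm _ _ (Permutation_map h HE)) as P2.
    rewrite map_app, list_Rsum_app in P1, P2. rewrite !list_Rsum_sym_range in *.
    specialize (H1 M ltac:(unfold M, N; lia)) as K1.
    specialize (H1 N ltac:(unfold N; lia)) as K2.
    apply Rabs_def2 in K1. apply Rabs_def2 in K2.
    pose proof (list_Rsum_Cmod_ge_0 g E'). fold h in H.
    rewrite P2 in P1. lra. }
  rewrite (list_Csum_perm _ _ (Permutation_map g HE)), map_app, list_Csum_app,
    list_Csum_sym_range.
  specialize (H2 N ltac:(unfold N; lia)). unfold ball_norm in H2; simpl in H2.
  set (x := sum_n _ N) in *.
  change (Cmod (x - s)%C < eps / 2) in H2.
  replace (x + list_Csum (map g E) - s)%C with ((x - s) + list_Csum (map g E))%C by ring.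
  eapply Rle_lt_trans; [apply Cmod_triangle|].
  pose proof (Cmod_list_Csum_le g E) as H3. fold h in H3. lra.
Qed.

(** * Decay estimates and assembly *)

(** Squaring exp (x/2) >= 1 + x/2 gives exp x >= 1 + x + x^2/4, while exp (-x) <= 1. The quadratic
    bound will provide summability, the linear one a lower bound away from 0. *)
Lemma sinh_lower_bounds (x : R) : 0 <= x -> x / 2 <= sinh x /\ x ^ 2 / 8 <= sinh x.
Proof.
  intros Hx. unfold sinh.
  pose proof (exp_ineq1_le (x / 2)) as H1.
  assert (H2 : exp x = exp (x / 2) * exp (x / 2)) by (rewrite <- exp_plus; f_equal; field).
  assert (H3 : exp (- x) <= 1).
  { rewrite <- exp_0. destruct Hx as [Hx| <-]; [left; apply exp_increasing; lra|].
    right. f_equal. ring. }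
  assert (H4 : (1 + x / 2) * (1 + x / 2) <= exp x) by (rewrite H2; nra).
  split; nra.
Qed.

Lemma sinh_opp (x : R) : sinh (- x) = - sinh x.
Proof. unfold sinh. rewrite Ropp_involutive. field. Qed.

Lemma cosh_opp (x : R) : cosh (- x) = cosh x.
Proof. unfold cosh. rewrite Ropp_involutive. field. Qed.

Lemma Rabs_sinh (x : R) : Rabs (sinh x) = sinh (Rabs x).
Proof.
  unfold Rabs at 2. destruct (Rcase_abs x) as [H|H].
  - rewrite sinh_opp. apply Rabs_left. apply sinh_lt in H. now rewrite sinh_0 in H.
  - apply Rabs_right. destruct (sinh_lower_bounds x) as [H1 _]; lra.
Qed.

(** With x = (j+1) |b|, one factor 1 / sinh x is at most 8 / x^2, and each of the other q is at most
    2 / |b| because x >= |b|. *)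
Lemma inv_sinh_pow_bound (b : R) (q : nat) : b <> 0 -> exists K, 0 <= K /\
  forall j : nat, Rabs (/ sinh (INR (S j) * b) ^ (q + 1)) <= K / (INR j + 1) ^ 2.
Proof.
  intros Hb. pose proof (Rabs_pos_lt b Hb) as HB. set (B := Rabs b) in *.
  assert (HiB : 0 < / B) by now apply Rinv_0_lt_compat.
  exists (8 * / B ^ 2 * (2 * / B) ^ q). split.
  { apply Rmult_le_pos; [|apply pow_le; lra].
    assert (0 < / B ^ 2) by now apply Rinv_0_lt_compat, pow_lt. lra. }
  intros j. rewrite Rabs_inv, <- RPow_abs, Rabs_sinh, Rabs_mult. fold B.
  pose proof (pos_INR j) as Hj. rewrite (Rabs_right (INR (S j))), S_INR by (rewrite S_INR; lra).
  set (x := (INR j + 1) * B).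
  assert (Hx : B <= x) by (unfold x; nra).
  destruct (sinh_lower_bounds x) as [H1 H2]; [lra|].
  assert (Hs : 0 < sinh x) by lra.
  rewrite <- pow_inv, pow_add, pow_1.
  assert (H3 : 0 <= / sinh x <= 2 * / B).
  { split; [now left; apply Rinv_0_lt_compat|].
    replace (2 * / B) with (/ (B / 2)) by (field; lra). apply Rinv_le_contravar; lra. }
  assert (H4 : / sinh x <= 8 * / B ^ 2 / (INR j + 1) ^ 2).
  { replace (8 * / B ^ 2 / (INR j + 1) ^ 2) with (/ (x ^ 2 / 8))
      by (unfold x; field; lra).
    apply Rinv_le_contravar; [|exact H2].
    assert (0 < x ^ 2) by (apply pow_lt; lra). lra. }
  replace (8 * / B ^ 2 * (2 * / B) ^ q / (INR j + 1) ^ 2) with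
    ((2 * / B) ^ q * (8 * / B ^ 2 / (INR j + 1) ^ 2)) by (unfold Rdiv; ring).
  apply Rmult_le_compat; [apply pow_le; lra|lra|now apply pow_incr|exact H4].
Qed.

(** For z >= 0, cosh z - sinh z = exp (-z) <= 1, so |cosh| <= |sinh| + 1 and the quotient splits
    into the inverse powers q + 1 and q + 2. *)
Lemma cosh_sinh_pow_bound (b : R) (q : nat) : b <> 0 -> exists K, 0 <= K /\
  forall j : nat, Rabs (cosh (INR (S j) * b) / sinh (INR (S j) * b) ^ (q + 2))
                  <= K / (INR j + 1) ^ 2.
Proof.
  intros Hb. destruct (inv_sinh_pow_bound b q Hb) as [K1 [HK1 H1]].
  destruct (inv_sinh_pow_bound b (q + 1) Hb) as [K2 [HK2 H2]].
  exists (K1 + K2). split; [lra|]. intros j. specialize (H1 j). specialize (H2 j).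
  set (x := INR (S j) * b) in *.
  assert (Hx : sinh x <> 0).
  { apply sinh_neq_0. unfold x. apply Rmult_integral_contrapositive.
    split; [now apply not_0_INR|exact Hb]. }
  replace (q + 1 + 1)%nat with (q + 2)%nat in H2 by lia.
  assert (Hc : Rabs (cosh x) <= Rabs (sinh x) + 1).
  { rewrite Rabs_sinh. replace (cosh x) with (cosh (Rabs x)).
    2:{ unfold Rabs. destruct (Rcase_abs x); [apply cosh_opp|easy]. }
    pose proof (Rabs_pos x) as Hp. set (z := Rabs x) in *.
    assert (H3 : exp (- z) <= 1).
    { rewrite <- exp_0. destruct Hp as [Hp|Hp]; [left; apply exp_increasing; lra|].
      right. f_equal. lra. }
    pose proof (exp_pos z). pose proof (exp_pos (- z)). unfold cosh, sinh.
    rewrite Rabs_right; lra. }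
  assert (E : Rabs (sinh x) * Rabs (/ sinh x ^ (q + 2)) = Rabs (/ sinh x ^ (q + 1))).
  { rewrite <- Rabs_mult. f_equal. replace (q + 2)%nat with (S (q + 1)) by lia.
    simpl. field. split; [now apply pow_nonzero|exact Hx]. }
  unfold Rdiv at 1. rewrite Rabs_mult.
  pose proof (Rabs_pos (/ sinh x ^ (q + 2))).
  unfold Rdiv. rewrite Rmult_plus_distr_r. unfold Rdiv in H1, H2. nra.
Qed.

Lemma ex_series_inv_sq_C (u : nat -> C) (K : R) : 0 <= K ->
  (forall n, Cmod (u n) <= K / (INR n + 1) ^ 2) ->
  ex_series (V := C_NormedModule) u.
Proof.
  intros HK Hu.
  apply (ex_series_le (K := C_AbsRing) (V := C_CompleteNormedModule) u
           (fun n => K / (INR n + 1) ^ 2)); [exact Hu|].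
  (* The real criterion bounds the term of index n + 1, here K / (n+2)^2, by K / (n+1)^2. *)
  apply ex_series_inv_sq with K; [exact HK|]. intros n. rewrite S_INR.
  pose proof (pos_INR n) as Hn.
  assert (0 < (INR n + 1) ^ 2) by (apply pow_lt; lra).
  assert (HB : / (INR n + 1 + 1) ^ 2 <= / (INR n + 1) ^ 2) by (apply Rinv_le_contravar; nra).
  assert (0 < / (INR n + 1 + 1) ^ 2) by (apply Rinv_0_lt_compat, pow_lt; lra).
  unfold Rdiv. rewrite Rabs_right by nra. nra.
Qed.

Lemma sum_n_inv_sq_bound (u : nat -> nat -> R) (k : nat) :
  (forall l, (l <= k)%nat -> exists K, 0 <= K /\
     forall j, Rabs (u l j) <= K / (INR j + 1) ^ 2) ->
  exists K, 0 <= K /\ forall j, Rabs (sum_n (fun l => u l j) k) <= K / (INR j + 1) ^ 2.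
Proof.
  induction k as [|k IH]; intros H.
  - destruct (H O (Nat.le_refl _)) as [K [HK HB]]. exists K. split; [exact HK|].
    intros j. now rewrite sum_O.
  - destruct IH as [K1 [HK1 HB1]]; [intros l Hl; apply H; lia|].
    destruct (H (S k) (Nat.le_refl _)) as [K2 [HK2 HB2]].
    exists (K1 + K2). split; [lra|]. intros j. rewrite sum_Sn_R.
    eapply Rle_trans; [apply Rabs_triang|]. specialize (HB1 j). specialize (HB2 j).
    unfold Rdiv in *. lra.
Qed.

Lemma is_series_sum_n (u : nat -> nat -> C) (T : nat -> C) (k : nat) :
  (forall l, (l <= k)%nat -> is_series (V := C_NormedModule) (u l) (T l)) ->
  is_series (V := C_NormedModule)
    (fun j => sum_n (G := C_AbelianMonoid) (fun l => u l j) k)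
    (sum_n (G := C_AbelianMonoid) T k).
Proof.
  induction k as [|k IH]; intros H.
  - rewrite sum_O. eapply is_series_ext; [|apply H, Nat.le_refl].
    intros n. now rewrite sum_O.
  - rewrite sum_Sn. eapply is_series_ext.
    2:{ apply (is_series_plus (V := C_NormedModule)); [apply IH; intros; apply H; lia|].
        apply H, Nat.le_refl. }
    intros n. now rewrite sum_Sn.
Qed.

Lemma vanishes_at_infty_bounded (f : Z -> C) : vanishes_at_infty f ->
  exists K, 0 <= K /\ forall m, Cmod (f m) <= K.
Proof.
  intros H. destruct (H 1 Rlt_0_1) as [M HM].
  assert (HN : forall N : nat, exists K, 0 <= K /\
            forall m, (Z.abs m <= Z.of_nat N)%Z -> Cmod (f m) <= K).
  { induction N as [|N [K [HK IH]]].
    - exists (Cmod (f 0%Z)). split; [apply Cmod_ge_0|].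
      intros m Hm. replace m with 0%Z by lia. lra.
    - pose proof (Cmod_ge_0 (f (Z.of_nat (S N)))).
      pose proof (Cmod_ge_0 (f (- Z.of_nat (S N))%Z)).
      exists (K + Cmod (f (Z.of_nat (S N))) + Cmod (f (- Z.of_nat (S N))%Z)).
      split; [lra|]. intros m Hm.
      assert (C : (Z.abs m <= Z.of_nat N)%Z \/ m = Z.of_nat (S N) \/ m = (- Z.of_nat (S N))%Z)
        by lia.
      destruct C as [C|[-> | ->]]; [specialize (IH m C); lra|lra|lra]. }
  destruct (HN (Z.to_nat M)) as [K [HK HB]]. exists (K + 1). split; [lra|]. intros m.
  destruct (Z.le_gt_cases (Z.abs m) (Z.of_nat (Z.to_nat M))) as [C|C].
  - specialize (HB m C). lra.
  - specialize (HM m ltac:(lia)). lra.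
Qed.

(* [sg] is the parity (1 or -1) of the functions [w l]. *)
Lemma double_sum_of_folded_series (f : Z -> C) (p k : nat) (a c sg : R)
  (coef : nat -> R) (w : nat -> R -> R) :
  vanishes_at_infty f -> a <> 0 -> Rabs sg = 1 ->
  (forall l x, w l (- x) = sg * w l x) ->
  (forall l, exists K, 0 <= K /\
     forall j, Rabs (w l (INR (S j) * PI / a)) <= K / (INR j + 1) ^ 2) ->
  (forall m, m <> 0%Z -> is_series (folded_term p (IZR m / a))
     (c * sum_n (fun l => coef l * w l (IZR m * PI / a)) k)) ->
  exists T : nat -> C,
    (forall l, is_series (V := C_NormedModule)
       (fun j => ((f (Z.of_nat (S j)) + RtoC sg * f (- Z.of_nat (S j))%Z)
                  * RtoC (w l (INR (S j) * PI / a)%R))%C) (T l)) /\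
    is_double_sum
      (fun m n => (f m * RtoC (powerRZ (-1) n)
                   / (RtoC (IZR m) + RtoC a * RtoC (IZR n) * Ci) ^ p)%C)
      (RtoC (c / a ^ p) * sum_n (G := C_AbelianMonoid) (fun l => (RtoC (coef l) * T l)%C) k)%C.
Proof.
  intros Hf Ha Hsg Hw Hb Hser.
  destruct (vanishes_at_infty_bounded f Hf) as [Kf [HKf Hfb]].
  set (u := fun l j => ((f (Z.of_nat (S j)) + RtoC sg * f (- Z.of_nat (S j))%Z)
                  * RtoC (w l (INR (S j) * PI / a)%R))%C).
  assert (Hex : forall l, ex_series (V := C_NormedModule) (u l)).
  { intros l. destruct (Hb l) as [K [HK HB]].
    apply ex_series_inv_sq_C with ((Kf + Kf) * K); [nra|]. intros n. unfold u.
    rewrite Cmod_mult, Cmod_R.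
    replace ((Kf + Kf) * K / (INR n + 1) ^ 2) with ((Kf + Kf) * (K / (INR n + 1) ^ 2))
      by (unfold Rdiv; ring).
    apply Rmult_le_compat; [apply Cmod_ge_0|apply Rabs_pos| |apply HB].
    eapply Rle_trans; [apply Cmod_triangle|]. rewrite Cmod_mult, Cmod_R, Hsg, Rmult_1_l.
    apply Rplus_le_compat; apply Hfb. }
  (* Choice turns the existence of a sum for each l into a single sequence. *)
  pose (T := fun l => proj1_sig (constructive_indefinite_description _ (Hex l))).
  assert (HT : forall l, is_series (V := C_NormedModule) (u l) (T l)).
  { intros l. exact (proj2_sig (constructive_indefinite_description _ (Hex l))). }
  exists T. split; [exact HT|].
  pose (s := fun x => sum_n (fun l => coef l * w l x) k).
  assert (Hs : forall x, s (- x) = sg * s x).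
  { intros x. unfold s. rewrite <- (sum_n_mult_l (K := R_AbsRing) sg).
    apply sum_n_ext. intros l. rewrite Hw. change (@mult R_AbsRing) with Rmult. eq_at R; ring. }
  assert (Hopp : forall j, IZR (- Z.of_nat (S j)) * PI / a = - (INR (S j) * PI / a)).
  { intros j. rewrite opp_IZR, <- INR_IZR_INZ. unfold Rdiv. ring. }
  exists (fun m => (f m * RtoC (c * s (IZR m * PI / a)%R / a ^ p))%C). split.
  { intros m Hm. apply is_symmetric_sum_inv_pow; [exact Ha|exact Hm|]. now apply Hser. }
  apply is_sum_nonzero_abs.
  - destruct (sum_n_inv_sq_bound (fun l j => coef l * w l (INR (S j) * PI / a)) k)
      as [K [HK HB]].
    { intros l _. destruct (Hb l) as [K [HK HB]]. exists (Rabs (coef l) * K).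
      split; [apply Rmult_le_pos; [apply Rabs_pos|exact HK]|].
      intros j. rewrite Rabs_mult.
      replace (Rabs (coef l) * K / (INR j + 1) ^ 2) with
        (Rabs (coef l) * (K / (INR j + 1) ^ 2)) by (unfold Rdiv; ring).
      apply Rmult_le_compat_l; [apply Rabs_pos|apply HB]. }
    pose proof (Rabs_pos (c / a ^ p)) as Hc.
    apply ex_series_inv_sq with (2 * (Kf * (Rabs (c / a ^ p) * K))); [repeat apply Rmult_le_pos; lra|].
    intros n.
    assert (Hbd : forall j, Cmod (f (Z.of_nat (S j)) * RtoC (c * s (IZR (Z.of_nat (S j)) * PI / a)%R / a ^ p))%C
        + Cmod (f (- Z.of_nat (S j))%Z * RtoC (c * s (IZR (- Z.of_nat (S j)) * PI / a)%R / a ^ p))%C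
        <= 2 * (Kf * (Rabs (c / a ^ p) * K)) / (INR j + 1) ^ 2).
    (* As |sg| = 1, the values of [s] at m and -m have the same modulus; this is the factor 2 in the
       bound. *)
    { intros j. rewrite Hopp, Hs, <- INR_IZR_INZ, !Cmod_mult, !Cmod_R.
      set (x := INR (S j) * PI / a).
      replace (c * s x / a ^ p) with (c / a ^ p * s x) by (unfold Rdiv; ring).
      replace (c * (sg * s x) / a ^ p) with (sg * (c / a ^ p * s x)) by (unfold Rdiv; ring).
      rewrite (Rabs_mult sg), Hsg, Rmult_1_l, Rabs_mult.
      specialize (HB j). fold x in HB. fold (s x) in HB.
      assert (H1 : Rabs (c / a ^ p) * Rabs (s x) <= Rabs (c / a ^ p) * (K / (INR j + 1) ^ 2))
        by now apply Rmult_le_compat_l.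
      assert (H0 : 0 <= Rabs (c / a ^ p) * Rabs (s x)) by (apply Rmult_le_pos; apply Rabs_pos).
      pose proof (Rmult_le_compat _ _ _ _ (Cmod_ge_0 _) H0 (Hfb (Z.of_nat (S j))) H1).
      pose proof (Rmult_le_compat _ _ _ _ (Cmod_ge_0 _) H0 (Hfb (- Z.of_nat (S j))%Z) H1).
      unfold Rdiv in *. lra. }
    rewrite Rabs_right by (apply Rle_ge, Rplus_le_le_0_compat; apply Cmod_ge_0).
    eapply Rle_trans; [apply Hbd|]. apply Rmult_le_compat_l; [repeat apply Rmult_le_pos; lra|].
    rewrite S_INR. pose proof (pos_INR n). apply Rinv_le_contravar; [apply pow_lt; lra|].
    apply pow_incr. lra.
  - eapply is_series_ext.
    2:{ apply (is_series_scal (K := C_AbsRing) (V := C_NormedModule)).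
        apply (is_series_sum_n (fun l j => (RtoC (coef l) * u l j)%C)
                 (fun l => (RtoC (coef l) * T l)%C)).
        intros l _. apply (is_series_scal (K := C_AbsRing) (V := C_NormedModule) (RtoC (coef l))).
        apply HT. }
    (* By parity the terms at m and -m share the factor [s x] up to the sign [sg], which leaves f(m)
       + sg f(-m). *)
    intros j. rewrite Hopp, Hs, <- INR_IZR_INZ.
    set (x := INR (S j) * PI / a).
    assert (E : sum_n (G := C_AbelianMonoid) (fun l => (RtoC (coef l) * u l j)%C) k
      = ((f (Z.of_nat (S j)) + RtoC sg * f (- Z.of_nat (S j))%Z) * RtoC (s x))%C).
    { unfold s. rewrite <- sum_n_RtoC. change Cmult with (@mult C_AbsRing) at 2.
      rewrite <- (sum_n_mult_l (K := C_AbsRing)). apply sum_n_ext. intros l.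
      change (@mult C_AbsRing) with Cmult. unfold u. fold x. rewrite RtoC_mult.
      eq_at C. ring. }
    rewrite E. change (@scal C_AbsRing C_NormedModule) with Cmult.
    replace (c * s x / a ^ p) with (c / a ^ p * s x) by (unfold Rdiv; ring).
    replace (c * (sg * s x) / a ^ p) with (sg * (c / a ^ p * s x)) by (unfold Rdiv; ring).
    rewrite !RtoC_mult.
    eq_at C. ring.
Qed.

Lemma pow_opp_even (x : R) (l : nat) : (- x) ^ (2 * l) = x ^ (2 * l).
Proof. rewrite !pow_mult. f_equal. ring. Qed.

(** [T l] names the series over m on the right-hand side, so that its convergence is part of the
    claim. *)
Theorem theorem3p1 (f : Z -> C) (k : nat) (a : R)
  (hf : vanishes_at_infty f) (hk : (1 <= k)%nat) (ha : a <> 0%R) :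
  (exists T : nat -> C,
     (forall l : nat, (l < k)%nat ->
        is_series (V := C_NormedModule)
          (fun j : nat =>
             let m := S j in
             ((f (Z.of_nat m) + f (- Z.of_nat m)%Z)
              * RtoC (cosh (INR m * PI / a))
              / RtoC (sinh (INR m * PI / a) ^ (2 * l + 2)))%C)
          (T l)) /\
     is_double_sum
       (fun m n : Z =>
          (f m * RtoC (powerRZ (-1) n)
           / (RtoC (IZR m) + RtoC a * RtoC (IZR n) * Ci) ^ (2 * k))%C)
       (RtoC (PI ^ (2 * k) / (a ^ (2 * k) * INR (fact (2 * k - 1))))
        * sum_n (G := C_AbelianMonoid)
            (fun l : nat =>
               (RtoC (INR (fact (2 * l + 1)) * INR (S_coef (k - 1) l)) * T l)%C)
            (k - 1))%C)
  /\
  (exists T : nat -> C,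
     (forall l : nat, (l < k)%nat ->
        is_series (V := C_NormedModule)
          (fun j : nat =>
             let m := S j in
             ((f (Z.of_nat m) - f (- Z.of_nat m)%Z)
              / RtoC (sinh (INR m * PI / a) ^ (2 * l + 1)))%C)
          (T l)) /\
     is_double_sum
       (fun m n : Z =>
          (f m * RtoC (powerRZ (-1) n)
           / (RtoC (IZR m) + RtoC a * RtoC (IZR n) * Ci) ^ (2 * k - 1))%C)
       (RtoC (PI ^ (2 * k - 1) / (a ^ (2 * k - 1) * INR (fact (2 * k - 2))))
        * sum_n (G := C_AbelianMonoid)
            (fun l : nat =>
               (RtoC (INR (fact (2 * l)) * INR (S_coef (k - 1) l)) * T l)%C)
            (k - 1))%C).
Proof.
  (* Writing k = j + 1 removes all truncated subtractions. *)
  destruct k as [|j]; [lia|].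
  replace (S j - 1)%nat with j by lia.
  replace (2 * S j - 1)%nat with (2 * j + 1)%nat by lia.
  replace (2 * S j - 2)%nat with (2 * j)%nat by lia.
  replace (2 * S j)%nat with (2 * j + 2)%nat by lia.
  pose proof PI_RGT_0 as HPI.
  assert (Hb : PI / a <> 0).
  { unfold Rdiv. apply Rmult_integral_contrapositive. split; [lra|now apply Rinv_neq_0_compat]. }
  assert (Hma : forall m, m <> 0%Z -> IZR m / a <> 0).
  { intros m Hm. apply not_0_IZR in Hm. unfold Rdiv. apply Rmult_integral_contrapositive.
    split; [exact Hm|now apply Rinv_neq_0_compat]. }
  assert (Hsinh : forall i, sinh (INR (S i) * PI / a) <> 0).
  { intros i. apply sinh_neq_0. unfold Rdiv. rewrite Rmult_assoc.
    apply Rmult_integral_contrapositive. split; [now apply not_0_INR|exact Hb]. }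
  destruct (is_series_folded_term j) as [Hodd Heven].
  split.
  - destruct (double_sum_of_folded_series f (2 * j + 2) j a
      (PI ^ (2 * j + 2) / INR (fact (2 * j + 1))) 1
      (fun l => INR (fact (2 * l + 1)) * INR (S_coef j l))
      (fun l x => cosh x / sinh x ^ (2 * l + 2))) as [T [HT HD]].
    + exact hf.
    + exact ha.
    + apply Rabs_R1.
    + intros l x. rewrite cosh_opp, sinh_opp.
      replace (2 * l + 2)%nat with (2 * (l + 1))%nat by lia. rewrite pow_opp_even. ring.
    + intros l. destruct (cosh_sinh_pow_bound (PI / a) (2 * l) Hb) as [K [HK HB]].
      exists K. split; [exact HK|]. intros i. specialize (HB i).
      replace (INR (S i) * PI / a) with (INR (S i) * (PI / a)) by (unfold Rdiv; ring).
      exact HB.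
    + intros m Hm. specialize (Heven _ (Hma m Hm)).
      replace (IZR m * PI / a) with (PI * (IZR m / a)) by (unfold Rdiv; ring). exact Heven.
    + exists T. split.
      * intros l _. eapply is_series_ext; [|apply HT]. intros i. cbv beta zeta.
        rewrite RtoC_div by (now apply pow_nonzero, Hsinh).
        eq_at C. unfold Cdiv. ring.
      * replace (PI ^ (2 * j + 2) / (a ^ (2 * j + 2) * INR (fact (2 * j + 1)))) with
          (PI ^ (2 * j + 2) / INR (fact (2 * j + 1)) / a ^ (2 * j + 2)).
        { exact HD. }
        field. split; [apply INR_fact_neq_0|now apply pow_nonzero].
  - destruct (double_sum_of_folded_series f (2 * j + 1) j a
      (PI ^ (2 * j + 1) / INR (fact (2 * j))) (-1)
      (fun l => INR (fact (2 * l)) * INR (S_coef j l))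
      (fun l x => / sinh x ^ (2 * l + 1))) as [T [HT HD]].
    + exact hf.
    + exact ha.
    + rewrite Rabs_left; lra.
    + intros l x. rewrite sinh_opp, !pow_add, pow_opp_even, !pow_1, <- Ropp_mult_distr_r, Rinv_opp.
      ring.
    + intros l. destruct (inv_sinh_pow_bound (PI / a) (2 * l) Hb) as [K [HK HB]].
      exists K. split; [exact HK|]. intros i. specialize (HB i).
      replace (INR (S i) * PI / a) with (INR (S i) * (PI / a)) by (unfold Rdiv; ring).
      exact HB.
    + intros m Hm. specialize (Hodd _ (Hma m Hm)).
      replace (IZR m * PI / a) with (PI * (IZR m / a)) by (unfold Rdiv; ring). exact Hodd.
    + exists T. split.
      * intros l _. eapply is_series_ext; [|apply HT]. intros i. cbv beta zeta.
        rewrite RtoC_inv by (now apply pow_nonzero, Hsinh).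
        replace (RtoC (-1)) with (- RtoC 1)%C by now rewrite <- RtoC_opp.
        eq_at C. unfold Cdiv. ring.
      * replace (PI ^ (2 * j + 1) / (a ^ (2 * j + 1) * INR (fact (2 * j)))) with
          (PI ^ (2 * j + 1) / INR (fact (2 * j)) / a ^ (2 * j + 1)).
        { exact HD. }
        field. split; [apply INR_fact_neq_0|now apply pow_nonzero].
Qed.
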